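(* Let $\mathcal{L}$ be a first-order language containing a binary relation symbol $E$, and let $T$ be an $\mathcal{L}$-theory stating that $E$ is symmetric and irreflexive. Let $\kappa\geq\aleph_0$ be a cardinal, $U$ a set, $\alpha\in\kappa^U$, and $\theta$ an ordinal with $\kappa<\theta$. Let $G=(V;E,\dots)\models T$ be an infinitary EM-model based on $(\alpha,\theta)$. Let $\varkappa>2^{2^{<(\kappa+\aleph_1)}}+|T|\cdot|U|$ be a regular cardinal. If the graph $(V,E)$ has $\chi(V,E)\geq\varkappa$, then there is $n\in\mathbb{N}$, $n\ge 1$, such that $(V,E)$ contains all finite subgraphs of $\mathrm{Sh}_n(\omega)$ (every finite subgraph of $\mathrm{Sh}_n(\omega)$ admits an injective graph homomorphism into $(V,E)$).
   Context: For a linear order $(I,<)$ and ordinal $\beta$, $(I^{\underline{\beta}})_<$ is the set of strictly increasing functions $\beta\to I$. For $\alpha\in\kappa^U$, a sequence $a=\langle a_{i,\eta}: i\in U,\ \eta\in(I^{\underline{\alpha_i}})_<\rangle$ of tuples of elements of $G$ is $(\alpha,I)$-indiscernible if for all $k<\omega$, $i_j\in U$ and $\eta_j,\rho_j\in(I^{\underline{\alpha_{i_j}}})_<$ ($j<k$), whenever a partial order-isomorphism $\pi$ of $I$ satisfies $\pi\circ\eta_j=\rho_j$ for all $j$, the tuples $\langle a_{i_j,\eta_j}\rangle_{j<k}$ and $\langle a_{i_j,\rho_j}\rangle_{j<k}$ have the same type. $G$ is an infinitary EM-model based on $(\alpha,I)$ if $G=\mathrm{dcl}(\mathrm{Rg}(a))$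 for such a sequence $a$. $2^{<\mu}=\sup\{2^\nu:\nu<\mu\}$. $\chi$ denotes chromatic number. The shift graph $\mathrm{Sh}_r(A)$ ($1\le r<\omega$, $(A,<)$ a linear order) has vertices the strictly increasing $r$-tuples from $A$, with $s,t$ adjacent iff $s(i)=t(i-1)$ for all $1\le i\le r-1$ or $t(i)=s(i-1)$ for all $1\le i\le r-1$ (for $r=1$, the complete graph on $A$). *)

(* Defs.v *)
From Stdlib Require List.
From mathcomp Require Import all_boot all_order.
From mathcomp Require Import boolp classical_sets functions cardinality.
From mathcomp Require wochoice.

Set Implicit Arguments.
Unset Strict Implicit.
Unset Printing Implicit Defensive.

Local Open Scope classical_set_scope.
Local Open Scope card_scope.
Local Open Scope order_scope.

(** * Cardinals and ordinals

    A cardinality is represented by a type, up to equipotence; an ordinal by a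
    well-ordered type, up to order isomorphism. *)

Definition card_leq (A B : Type) : Prop := [set: A] #<= [set: B].

Definition card_less (A B : Type) : Prop := card_leq A B /\ ~ card_leq B A.

Definition is_succ_card (A B : Type) : Prop :=
  card_less A B /\ forall C : Type, card_less A C -> card_leq B C.

(** [P] has cardinality [2^{<mu} = sup {2^nu : nu < mu}]. *)
Definition is_weak_power (mu P : Type) : Prop :=
  (forall nu : Type, card_less nu mu -> card_leq (set nu) P) /\
  (forall Q : Type,
     (forall nu : Type, card_less nu mu -> card_leq (set nu) Q) ->
     card_leq P Q).

Definition is_ordinal d (O : orderType d) : Prop :=
  wochoice.well_order (fun x y : O => x <= y).

(** Infinite initial ordinals. *)
Definition is_infinite_cardinal d (K : orderType d) : Prop :=
  [/\ is_ordinal K, infinite_set [set: K] &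
      forall b : K, ~ ([set: K] #<= [set x : K | x < b])].

Definition is_regular_cardinal d (K : orderType d) : Prop :=
  is_infinite_cardinal K /\
  forall A : set K, (forall x : K, exists2 y, A y & x <= y) -> [set: K] #<= A.

(** [O1] is isomorphic to a proper initial segment of [O2]. *)
Definition ordinal_less d1 (O1 : orderType d1) d2 (O2 : orderType d2) : Prop :=
  exists (b : O2) (f : O1 -> O2),
    (forall x y : O1, (f x < f y) = (x < y)) /\
    f @` [set: O1] = [set z : O2 | z < b].

(** The ordinal [b], as its set of predecessors. *)
Definition below d (K : orderType d) (b : K) : Type := {x : K | x < b}.

Definition incr_fun d (K : orderType d) (b : K) d' (I : orderType d') : Type :=
  {eta : below b -> I | forall x y : below b, sval x < sval y -> eta x < eta y}.

(** * First-order logic *)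

Record language : Type := Language {
  func : Type;
  func_arity : func -> nat;
  rel_symb : Type;
  rel_arity : rel_symb -> nat }.

(** Terms and formulas whose free variables are indexed by ['I_n]; in
    [All phi] the bound variable is [ord0] and the others are shifted by one. *)
Inductive term (L : language) (n : nat) : Type :=
  | Var of 'I_n
  | App (f : func L) of ('I_(func_arity f) -> term L n).

Inductive formula (L : language) : nat -> Type :=
  | Falsum n : formula L n
  | Equal n of term L n & term L n : formula L n
  | Rel n (R : rel_symb L) of ('I_(rel_arity R) -> term L n) : formula L n
  | Imp n of formula L n & formula L n : formula L n
  | All n of formula L n.+1 : formula L n.

Definition sentence (L : language) : Type := formula L 0.

Record structure (L : language) : Type := Structure {
  carrier :> Type;
  func_interp : forall f : func L, ('I_(func_arity f) -> carrier) -> carrier;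
  rel_interp : forall R : rel_symb L, ('I_(rel_arity R) -> carrier) -> Prop }.

Definition vcons (V : Type) n (x : V) (v : 'I_n -> V) : 'I_n.+1 -> V :=
  fun i => if unlift ord0 i is Some j then v j else x.

Fixpoint eval (L : language) (M : structure L) n (v : 'I_n -> M)
    (t : term L n) : M :=
  match t with
  | Var i => v i
  | App f ts => func_interp (fun i => eval v (ts i))
  end.

Fixpoint sat (L : language) (M : structure L) n (phi : formula L n) :
    ('I_n -> M) -> Prop :=
  match phi with
  | Falsum _ => fun _ => False
  | Equal _ t u => fun v => eval v t = eval v u
  | Rel _ R ts => fun v => rel_interp (fun i => eval v (ts i))
  | Imp _ phi psi => fun v => sat phi v -> sat psi v
  | All _ phi => fun v => forall x : M, sat phi (vcons x v)
  end.

Definition models (L : language) (M : structure L) (T : set (sentence L)) : Prop :=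
  forall phi, T phi -> forall v : 'I_0 -> M, sat phi v.

(** The complete type of a finite tuple over the empty set. The number of
    variables is part of a formula, so equality of types forces equality of
    lengths. *)
Definition tp (L : language) (M : structure L) (s : seq M) :
    set {n : nat & formula L n} :=
  [set p | exists2 phi : formula L (size s),
             p = existT _ (size s) phi & sat phi (tnth (in_tuple s))].

Definition dcl (L : language) (M : structure L) (A : set M) : set M :=
  [set b | exists2 s : seq M, (forall x, List.In x s -> A x) &
             exists phi : formula L (size s).+1,
               forall y : M, sat phi (vcons y (tnth (in_tuple s))) <-> y = b].

(** * Infinitary Ehrenfeucht-Mostowski models *)

(** [pi] is only meaningful on [D]; order-preserving in both directions on a
    linear order, it is injective there. *)
Definition partial_iso d (I : orderType d) (D : set I) (pi : I -> I) : Prop :=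
  forall x y, D x -> D y -> (pi x < pi y) = (x < y).

Definition indiscernible (L : language) (M : structure L) (U : Type)
    dk (kappa : orderType dk) (alpha : U -> kappa) di (I : orderType di)
    (a : forall i : U, incr_fun (alpha i) I -> seq M) : Prop :=
  forall (k : nat) (i : 'I_k -> U)
         (eta rho : forall j : 'I_k, incr_fun (alpha (i j)) I)
         (D : set I) (pi : I -> I),
    partial_iso D pi ->
    (forall j x, D (sval (eta j) x) /\ pi (sval (eta j) x) = sval (rho j) x) ->
    tp (flatten [seq a (i j) (eta j) | j <- enum 'I_k]) =
    tp (flatten [seq a (i j) (rho j) | j <- enum 'I_k]).

Definition Rg (V U : Type) (X : U -> Type) (a : forall i : U, X i -> seq V) :
    set V :=
  [set x | exists i (eta : X i), List.In x (a i eta)].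

Definition infinitary_EM_model (L : language) (M : structure L) (U : Type)
    dk (kappa : orderType dk) (alpha : U -> kappa) di (I : orderType di) : Prop :=
  exists2 a : forall i : U, incr_fun (alpha i) I -> seq M,
    indiscernible a & dcl (Rg a) = [set: M].

(** * Graphs *)

(** Intended for [R] of arity 2. *)
Definition edge (L : language) (R : rel_symb L) (M : structure L) (x y : M) : Prop :=
  rel_interp (fun i : 'I_(rel_arity R) => if val i == 0%N then x else y).

Definition graph_rel (V : Type) (E : V -> V -> Prop) : Prop :=
  (forall x y, E x y -> E y x) /\ (forall x, ~ E x x).

Definition graph_theory (L : language) (R : rel_symb L) (T : set (sentence L)) : Prop :=
  forall M : structure L, models M T -> graph_rel (edge R (M := M)).

Definition colourable (V : Type) (E : V -> V -> Prop) (C : Type) : Prop :=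
  exists c : V -> C, forall x y, E x y -> c x <> c y.

Definition is_chromatic_number (V : Type) (E : V -> V -> Prop) (C : Type) : Prop :=
  colourable E C /\ forall C' : Type, colourable E C' -> card_leq C C'.

Definition shift_vertex (r : nat) d (A : orderType d) : Type :=
  {s : r.-tuple A | sorted (fun x y : A => x < y) s}.

(** [s <> t] only matters for [r = 1], where it makes [Sh_1(A)] the complete
    graph on [A]; for [r >= 2] it follows from the other condition. *)
Definition shift_edge (r : nat) d (A : orderType d) (s t : shift_vertex r A) : Prop :=
  s <> t /\
  ((forall i j : 'I_r, i = j.+1 :> nat -> tnth (sval s) i = tnth (sval t) j) \/
   (forall i j : 'I_r, i = j.+1 :> nat -> tnth (sval t) i = tnth (sval s) j)).

(** Every finite subgraph [(W, F)] of [(X, S)] has an injective homomorphism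
    into [(V, E)]. *)
Definition contains_finite_subgraphs (V : Type) (E : V -> V -> Prop)
    (X : Type) (S : X -> X -> Prop) : Prop :=
  forall (W : set X) (F : X -> X -> Prop),
    finite_set W ->
    graph_rel F ->
    (forall s t, F s t -> [/\ W s, W t & S s t]) ->
    exists f : X -> V,
      (forall s t, W s -> W t -> f s = f t -> s = t) /\
      (forall s t, F s t -> E (f s) (f t)).

(* Main.v *)
Require Import Defs.
From mathcomp Require Import all_boot all_order all_algebra zify.
From mathcomp Require Import boolp classical_sets functions cardinality.

(* A vertex is defined by a formula from finitely many entries of the sequence,
   hence is coded by one function [f : X -> theta] with [X] of size below
   [kappa], and adjacency of two vertices only depends on the order type of the
   pair of codes.  By regularity of [varkappa] it is enough to colour, with at
   most [2^(2^(<kappa + aleph1))] colours, the vertices sharing a formula and an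
   order type of [f]; and there it is enough to colour, with continuum many
   colours, the graph of a single order type of pairs [(f, g)].  Let [u x] be the
   least [y] with [f x <= g y].  If on the part where [f x < g x] the iterates
   of [u] do not stabilise after boundedly many steps, or symmetrically for
   [(g, f)], then there are arbitrarily long blocks of indices with
   [f x_(k+1) <= g x_k < f x_(k+2)].  Walks shift such blocks by boundedly many
   places, and comparing them with a fixed member of the component is a
   colouring.  Otherwise each index has a bounded rank, and substituting the
   entries of an increasing tuple for the ranks yields functions on which the
   shift is the given order type, so that the model contains homomorphic images
   of finite parts of a shift graph.  As equality of vertices is an invariant
   equivalence relation on tuples, the images can be made injective by changing
   the length of the tuples. *)

Set Implicit Arguments.
Unset Strict Implicit.
Unset Printing Implicit Defensive.

Import Order.TTheory.
Local Open Scope classical_set_scope.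

(** * Cardinal arithmetic *)

Lemma sval_inj (T : Type) (P : T -> Prop) : injective (@sval T P).
Proof. by move=> [x Px] [y Py] /= E; apply/eq_exist. Qed.

Lemma card_leqP (A B : Type) :
  card_leq A B <-> exists f : A -> B, injective f.
Proof.
split=> [/card_leP[g]|[f f_inj]].
  exists (fun x => val (g (SigSub (mem_set (I : [set: A] x))))) => x y /val_inj E.
  by have [] := @inj _ _ _ g _ _ (in_setT _) (in_setT _) E.
have [] : $|{injfun [set: A] >-> [set: B]}|; last exact: inj_card_le.
by apply/injfunPex; exists f => // x y _ _; exact: f_inj.
Qed.

Lemma card_leq_refl (A : Type) : card_leq A A.
Proof. by apply/card_leqP; exists id. Qed.

Lemma card_leq_trans (A B C : Type) :
  card_leq A B -> card_leq B C -> card_leq A C.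
Proof.
move=> /card_leqP[f fi] /card_leqP[g gi]; apply/card_leqP.
by exists (g \o f); apply: inj_comp.
Qed.

Lemma card_leq_prod (A B C D : Type) :
  card_leq A B -> card_leq C D -> card_leq (A * C) (B * D).
Proof.
move=> /card_leqP[f fi] /card_leqP[g gi]; apply/card_leqP.
by exists (fun p => (f p.1, g p.2)) => -[a c] [a' c'] [/fi -> /gi ->].
Qed.

Lemma card_leq_set (A B : Type) : card_leq A B -> card_leq (set A) (set B).
Proof.
move=> /card_leqP[f fi]; apply/card_leqP; exists (fun S => f @` S).
suff sub S S' : f @` S = f @` S' -> S `<=` S'.
  by move=> S S' E; apply/seteqP; split; apply: sub.
move=> E x Sx; have : (f @` S) (f x) by exists x.
by rewrite E => -[y Sy /fi <-].
Qed.

(** Zorn's lemma for partial injections: a maximal one is total or surjective, since two unmatched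
    points could be added to it as a new pair. *)
Lemma card_leq_total (A B : Type) : card_leq A B \/ card_leq B A.
Proof.
pose P (G : set (A * B)) := forall p q, G p -> G q -> p.1 = q.1 <-> p.2 = q.2.
have [|G [PG Gmax]] := @Zorn_bigcup _ P.
  move=> F FP Ftot p q [X FX Xp] [Y FY Yq].
  by case: (Ftot X Y FX FY) => [XY|YX]; [apply: (FP Y)|apply: (FP X)]; auto.
case: (pselect (forall a, exists b, G (a, b))) => [/choice[f fG]|/existsNP[a aN]].
  left; apply/card_leqP; exists f => x y E.
  exact/(PG _ _ (fG x) (fG y)).
case: (pselect (forall b, exists a, G (a, b))) => [/choice[f fG]|/existsNP[b bN]].
  right; apply/card_leqP; exists f => x y E.
  exact/(PG _ _ (fG x) (fG y)).
exfalso; apply: (Gmax (G `|` [set (a, b)])).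
  split; first exact: subsetUl.
  by move=> /(_ (a, b)) /= H; apply: aN; exists b; apply: H; right.
move=> [x y] [x' y'] [Gp|/= [-> ->]] [Gq|/= [-> ->]] //=.
- exact: (PG (x, y) (x', y')).
- by split=> E; subst; [case: aN; exists y|case: bN; exists x].
- by split=> E; subst; [case: aN; exists y'|case: bN; exists x'].
Qed.

(** Zorn's lemma for injections [D * D -> D] on infinite subsets [D] of [Z]; [Z] is shown to embed
    in a maximal [D]. *)
Lemma card_leq_square (Z : Type) : card_leq nat Z -> card_leq (Z * Z) Z.
Proof.
move=> /card_leqP[j ji].
pose D (G : set (Z * Z * Z)) x := exists z, G (x, x, z).
pose P (G : set (Z * Z * Z)) :=
  [/\ forall x y z, G (x, y, z) -> [/\ D G x, D G y & D G z],
      forall x y, D G x -> D G y -> exists z, G (x, y, z),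
      forall p q, G p -> G q -> p.1 = q.1 <-> p.2 = q.2 &
      G !=set0 -> exists2 h : nat -> Z, injective h & forall n, D G (h n)].
have [|G [[G1 G2 G3 G4] Gmax]] := @Zorn_bigcup _ P.
  move=> F FP Ftot.
  have sub X : F X -> (X `<=` \bigcup_(X in F) X) by move=> FX p Xp; exists X.
  have subD X x : F X -> D X x -> D (\bigcup_(X in F) X) x.
    by move=> FX [z Xz]; exists z; apply: sub Xz.
  split=> [x y z [X FX Xp]|x y [z [X FX Xz]] [z' [Y FY Yz']]||[p [X FX Xp]]].
  - have [X1 _ _ _] := FP _ FX.
    by have [? ? ?] := X1 _ _ _ Xp; split; apply: subD FX _.
  - wlog {z z' Xz Yz'} [Z0 FZ [Zx Zy]] : / exists2 Z0, F Z0 & D Z0 x /\ D Z0 y.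
      apply; case: (Ftot X Y FX FY) => [XY|YX]; [exists Y|exists X] => //.
        by split; [exists z; apply: XY|exists z'].
      by split; [exists z|exists z'; apply: YX].
    have [_ Z2 _ _] := FP _ FZ.
    by have [w Zw] := Z2 _ _ Zx Zy; exists w, Z0.
  - move=> p q [X FX Xp] [Y FY Yq].
    case: (Ftot X Y FX FY) => [XY|YX].
      by have [_ _ Y3 _] := FP _ FY; apply: Y3 => //; apply: XY.
    by have [_ _ X3 _] := FP _ FX; apply: X3 => //; apply: YX.
  - have [_ _ _ X4] := FP _ FX.
    have [|h hi hD] := X4; first by exists p.
    by exists h => // n; apply: subD FX _.
have Gn0 : G !=set0.
  apply: contrapT => GN.
  pose c (m n : nat) : nat := pickle (m, n).
  have ci m n m' n' : c m n = c m' n' -> m = m' /\ n = n'.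
    by move=> /(pcan_inj pickleK) [].
  pose H : set (Z * Z * Z) :=
    fun p => exists m n, p = (j m, j n, j (c m n)).
  have HD n : D H (j n) by exists (j (c n n)), n, n.
  apply: (Gmax H).
    split=> [p Gp|HG]; first by case: GN; exists p.
    by apply: GN; exists (j 0, j 0, j (c 0 0)); apply: HG; exists 0, 0.
  split=> [_ _ _ [m [n [-> -> ->]]]|x y [z [m [_ [-> _ _]]]] [z' [n [_ [-> _ _]]]]||_].
  - by split; apply: HD.
  - by exists (j (c m n)), m, n.
  - move=> _ _ [m [n ->]] [m' [n' ->]] /=.
    by split=> [[/ji -> /ji ->]//|/ji/ci[-> ->]].
  - by exists j.
have [h hi hD] := G4 Gn0.
pose Dt := {x | D G x}.
have Dsq : card_leq (Dt * Dt) Dt.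
  have ex (p : Dt * Dt) : exists z : Dt, G (sval p.1, sval p.2, sval z).
    case: p => [[x Dx] [y Dy]] /=.
    have [z Gz] := G2 _ _ Dx Dy; have [_ _ Dz] := G1 _ _ _ Gz.
    by exists (exist _ z Dz).
  have [f fG] := choice ex.
  apply/card_leqP; exists f => p q E.
  have [_ /= /(_ (congr1 sval E))[E1 E2]] := G3 _ _ (fG p) (fG q).
  by case: p q E1 E2 {E} => [a b] [a' b'] /= /sval_inj -> /sval_inj ->.
have Dbool : card_leq (Dt + Dt) Dt.
  apply: card_leq_trans Dsq; apply/card_leqP.
  exists (fun s => match s with
    | inl x => (exist _ _ (hD 0), x) | inr x => (exist _ _ (hD 1), x) end).
  by move=> [x|x] [y|y] //= [] => [->|/hi|/hi|->].
have Dd (x : Z) : D G x + {~ D G x} by case: (pselect (D G x)); [left|right].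
pose Nt := {x | ~ D G x}.
(* If the complement of the domain embeds in the domain, [Z] embeds in two copies of the domain.
   Otherwise the complement contains a copy [B] of the domain, and sending the new pairs over the
   union of both into [B] enlarges [G]. *)
case: (card_leq_total Nt Dt) => [ND|/card_leqP[k ki]].
  have ZD : card_leq Z Dt.
    apply: card_leq_trans Dbool; move: ND => /card_leqP[k ki]; apply/card_leqP.
    exists (fun x => match Dd x with
      | inleft H => inl (exist _ x H) | inright H => inr (k (exist _ x H)) end).
    move=> x y; case: (Dd x) => Hx; case: (Dd y) => Hy //.
      by move=> [].
    by move=> [/ki[]].
  apply: card_leq_trans (card_leq_prod ZD ZD) _; apply: card_leq_trans Dsq _.
  by apply/card_leqP; exists sval; apply: sval_inj.
exfalso.
pose B x := exists d, x = sval (k d).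
have BN x : B x -> ~ D G x by move=> [d ->]; apply: (svalP (k d)).
pose At := {x | D G x \/ B x}.
have AD : card_leq At Dt.
  apply: card_leq_trans Dbool; apply/card_leqP.
  have ex (a : At) : exists s : Dt + Dt,
     sval a = match s with inl d => sval d | inr d => sval (k d) end.
    case: (svalP a) => [Da|[d E]]; first by exists (inl (exist _ _ Da)).
    by exists (inr d).
  have [f fE] := choice ex; exists f => p q E.
  by apply: sval_inj; rewrite fE E -fE.
have [g gi] : exists g : At * At -> Dt, injective g.
  apply/card_leqP; apply: card_leq_trans (card_leq_prod AD AD) Dsq.
pose H : set (Z * Z * Z) := fun p => exists a b : At,
  [/\ p.1 = (sval a, sval b), ~ (D G (sval a) /\ D G (sval b)) &
      p.2 = sval (k (g (a, b)))].
have HB p : H p -> B p.2 by move=> [a [b [_ _ ->]]]; exists (g (a, b)).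
have GD p : G p -> D G p.2 by case: p => [[x y] z] /G1[].
have DU x : D (G `|` H) x <-> D G x \/ B x.
  split=> [[z [Gz|[a [b [/= [-> _] _ _]]]]]|[[z Gz]|Bx]].
  - by left; exists z.
  - exact: (svalP a).
  - by exists z; left.
  - pose a : At := exist _ x (or_intror Bx).
    by exists (sval (k (g (a, a)))); right; exists a, a; split=> //= -[/BN].
apply: (Gmax (G `|` H)).
  split; first exact: subsetUl.
  move=> UG; pose b := k (exist _ _ (hD 0)).
  have [z /UG Gz] : D (G `|` H) (sval b) by apply/DU; right; exists (exist _ _ (hD 0)).
  by apply: (svalP b); exists z.
split=> [x y z [Gz|Hz]|x y /DU Hx /DU Hy||_].
- by have [? ? ?] := G1 _ _ _ Gz; split; apply/DU; left.
- have := HB _ Hz; case: Hz => a [b [/= [-> ->] _ _]] Bz.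
  by split; apply/DU; [exact: (svalP a)|exact: (svalP b)|right].
- case: (pselect (D G x /\ D G y)) => [[Dx Dy]|ND].
    by have [z Gz] := G2 _ _ Dx Dy; exists z; left.
  pose a : At := exist _ x Hx; pose b : At := exist _ y Hy.
  by exists (sval (k (g (a, b)))); right; exists a, b.
- move=> p q [Gp|Hp] [Gq|Hq]; first exact: G3.
  + split=> E; last by case: (BN _ (HB _ Hq)); rewrite -E; apply: GD.
    case: Hq => a [b [Eq ND _]]; case: ND.
    by case: p Gp E => [[x y] z] /G1[Dx Dy _] /= E; rewrite -E in Eq; case: Eq => <- <-.
  + split=> E; last by case: (BN _ (HB _ Hp)); rewrite E; apply: GD.
    case: Hp => a [b [Ep ND _]]; case: ND.
    by case: q Gq E => [[x y] z] /G1[Dx Dy _] /= E; rewrite E in Ep; case: Ep => <- <-.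
  + case: Hp Hq => a [b [-> _ ->]] [a' [b' [-> _ ->]]]; split=> [[Ea Eb]|E].
      by rewrite (sval_inj Ea) (sval_inj Eb).
    by have [-> ->] := gi _ _ (ki _ _ (sval_inj E)).
- by exists h => // n; apply/DU; left.
Qed.

Lemma card_le_setP (A T : Type) (B : set T) :
  ([set: A] #<= B)%card <-> card_leq A {x | B x}.
Proof.
split=> [/card_leP[g]|/card_leqP[f fi]].
  apply/card_leqP; pose h x := g (SigSub (mem_set (I : [set: A] x))).
  exists (fun x => exist _ (val (h x)) (set_mem (valP (h x)))).
  move=> x y /(congr1 sval) /= /val_inj E.
  by have [] := @inj _ _ _ g _ _ (in_setT _) (in_setT _) E.
have [] : $|{injfun [set: A] >-> B}|; last exact: inj_card_le.
apply/injfunPex; exists (sval \o f); first by move=> x _; apply: svalP.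
by move=> x y _ _ /sval_inj /fi.
Qed.

Lemma finite_card_leq (A : Type) :
  ~ card_leq nat A -> exists n : nat, card_leq A 'I_n.
Proof.
move=> nA; have [n] : finite_set [set: A].
  by apply: contrapT => /infiniteP.
rewrite card_eq_le => /andP[/card_leP[g] _]; exists n; apply/card_leqP.
pose h x := g (SigSub (mem_set (I : [set: A] x))).
exists (fun x => Ordinal (set_mem (valP (h x)))).
move=> x y /(congr1 (@nat_of_ord n)) /= /val_inj E.
by have [] := @inj _ _ _ g _ _ (in_setT _) (in_setT _) E.
Qed.

(** * Unions and products of few small types below a regular cardinal *)

Section Regular.
Variables (d : Order.disp_t) (K : orderType d).
Hypothesis Kreg : is_regular_cardinal K.

Lemma regular_bounded (A : Type) (f : A -> K) :
  ~ card_leq K A -> exists b, forall x, (f x < b)%O.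
Proof.
move=> nKA; apply: contrapT => nb; apply: nKA.
have [_ /(_ (range f)) H] := Kreg.
have /card_le_setP/card_leqP[g gi] : ([set: K] #<= range f)%card.
  apply: H => x; apply: contrapT => nx; apply: nb; exists x => y.
  by rewrite ltNge; apply/negP => xy; apply: nx; exists (f y).
have ex x : exists a, f a = sval (g x) by case: (svalP (g x)) => a _ E; exists a.
have [h hE] := choice ex; apply/card_leqP; exists h => x y E.
by apply: gi; apply: sval_inj; rewrite -!hE E.
Qed.

(** An injection from [K] splits [K] into fibres. Each is bounded since [C a] is small, and the
    bounds lie below some [c] since [A] is small; but [c] is below the bound of its own fibre. *)
Lemma regular_sigma (A : Type) (C : A -> Type) :
  ~ card_leq K A -> (forall a, ~ card_leq K (C a)) -> ~ card_leq K {a & C a}.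
Proof.
move=> nA nC /card_leqP[j ji].
have ex a : exists b : K, forall x, tag (j x) = a -> (x < b)%O.
  have [|b bP] := @regular_bounded {x | tag (j x) = a} sval.
    move=> le; apply: (nC a); apply: card_leq_trans le _; apply/card_leqP.
    have ex (x : {x | tag (j x) = a}) : exists c, j (sval x) = existT _ a c.
      case: x => x /=; case: (j x) => a' c /= E.
      by move: c; rewrite E => c; exists c.
    have [g gE] := choice ex; exists g => x y E.
    by apply: sval_inj; apply: ji; rewrite !gE E.
  by exists b => x xa; apply: (bP (exist _ x xa)).
have [b bP] := choice ex; have [c cP] := regular_bounded b nA.
by have := lt_trans (bP _ c erefl) (cP _); rewrite ltxx.
Qed.

Lemma regular_prod (A B : Type) :
  ~ card_leq K A -> ~ card_leq K B -> ~ card_leq K (A * B).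
Proof.
move=> nA nB KAB; apply: (@regular_sigma A (fun=> B)) => //.
apply: card_leq_trans KAB _; apply/card_leqP.
by exists (fun p => existT (fun=> B) p.1 p.2) => -[a b] [a' b'] [-> ->].
Qed.

Lemma regular_fun (A : Type) n : ~ card_leq K A -> ~ card_leq K ('I_n -> A).
Proof.
move=> nA; elim: n => [|n IH] le.
  have [[_ Kinf _] _] := Kreg; move: Kinf => /infiniteP/card_leqP[j ji].
  move: le => /card_leqP[g gi]; have E : g (j 0) = g (j 1).
    by apply/funext => -[].
  by have /ji := gi _ _ E.
apply: (regular_prod nA IH); apply: card_leq_trans le _; apply/card_leqP.
exists (fun f => (f ord0, fun i => f (lift ord0 i))) => f g [E0 E].
by apply/funext => i; case: (unliftP ord0 i) => [i' ->|->] //; apply: (congr1 (@^~ i') E).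
Qed.

End Regular.

Lemma wo_min d (O : orderType d) (P : O -> Prop) : is_ordinal O ->
  (exists x, P x) -> exists2 x, P x & forall y, P y -> (x <= y)%O.
Proof.
move=> wO [x Px]; have [|m [[Pm mP] _]] := wO (fun y => `[< P y >]).
  by exists x; apply/asboolP.
by exists m => [|y Py]; [apply/asboolP|apply: mP; apply/asboolP].
Qed.

(* [h] ranges over a well-founded part of a linear order; its rank function
   embeds that part into any ordinal that [Y] cannot cover. *)
Lemma collapse d (K : orderType d) dO (O : orderType dO) (Y : Type)
    (h : Y -> O) :
  is_ordinal K -> ~ card_leq K Y ->
  well_founded (fun y z => (h y < h z)%O) ->
  exists rho : Y -> K, forall y z, (rho y < rho z)%O = (h y < h z)%O.
Proof.
move=> wK nKY wf.
have [k0 _] : exists k0 : K, True.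
  apply: contrapT => nK; apply: nKY; apply/card_leqP.
  exists (fun k => False_rect _ (nK (ex_intro _ k I))) => x.
  by exfalso; apply: nK; exists x.
pose isrk (r : Y -> K) y k := (forall z, (h z < h y)%O -> (r z < k)%O) /\
  forall k', (forall z, (h z < h y)%O -> (r z < k')%O) -> (k <= k')%O.
pose F y (r : forall z, (h z < h y)%O -> K) : K :=
  xget k0 [set k | (forall z Hz, (r z Hz < k)%O) /\
    forall k', (forall z Hz, (r z Hz < k')%O) -> (k <= k')%O].
pose rho := Fix wf (fun=> K) F.
have rhoE y : rho y = F y (fun z _ => rho z).
  apply: (Fix_eq wf (fun=> K) F) => x f g fg; congr F.
  by apply: functional_extensionality_dep => z; apply: functional_extensionality_dep => H.
have isrkE y : isrk rho y (rho y).
  elim/(well_founded_ind wf): y => y IH; rewrite rhoE /F.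
  case: xgetP => [k _ //|/(_ _) N].
  case: (pselect (exists b, forall z, (h z < h y)%O -> (rho z < b)%O)) => [ub|nb].
    by have [k kP kmin] := wo_min wK ub; apply: (N k).
  apply: nKY.
  (* A rank is the least strict bound of the ranks before it, so ranks cannot jump over [b]. Hence
     if the ranks below [y] are unbounded they exhaust [K], and [K] embeds in [Y]. *)
  have ex : forall b : K, exists2 z, (h z < h y)%O & rho z = b.
    move=> b; apply: contrapT => nz; apply: nb; exists b => z zy.
    elim/(well_founded_ind wf): z => z IHz in zy *.
    rewrite lt_neqAle; apply/andP; split.
      by apply/negP => /eqP E; apply: nz; exists z.
    have [_ rk] := IH _ zy; apply: rk => w wz; apply: IHz => //.
    exact: lt_trans wz zy.
  have ex' b : exists z, rho z = b by have [z _ E] := ex b; exists z.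
  have [g gE] := choice ex'; apply/card_leqP; exists g => b b' E.
  by rewrite -(gE b) E gE.
have lt_rho y z : (h y < h z)%O -> (rho y < rho z)%O.
  by move=> yz; have [H _] := isrkE z; apply: H.
exists rho => y z; case: (ltgtP (h y) (h z)) => [/lt_rho ->//|/lt_rho|E].
  by move=> /ltW; rewrite leNgt => /negbTE.
apply/negbTE; rewrite -leNgt; have [_ rk] := isrkE z; apply: rk => w.
by rewrite -E; have [H _] := isrkE y; apply: H.
Qed.

(** * Canonisation of shift graphs *)

(* A [n]-tuple is given by the first [n] values of a function on [nat], so that
   shifting is composition with [S]. *)
Definition inc d (T : porderType d) n (s : nat -> T) : Prop :=
  forall i j, (i < j)%N -> (j < n)%N -> (s i < s j)%O.

(** Only comparisons across the two tuples are recorded, those inside a tuple being fixed by [inc].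
    Integer entries leave room below the first and above the last entry. *)
Definition same_pattern n (s t s' t' : nat -> int) : Prop :=
  forall i j, (i < n)%N -> (j < n)%N ->
    (s i < t j)%O = (s' i < t' j)%O /\ (t j < s i)%O = (t' j < s' i)%O.

(** [R] and [A] abstract equality and adjacency of vertices attached to [n]-tuples. *)
Record shift_system n (R A : (nat -> int) -> (nat -> int) -> Prop) : Prop := {
  ss_pattern : forall s t s' t', inc n s -> inc n t -> inc n s' -> inc n t' ->
    same_pattern n s t s' t' -> R s t -> R s' t';
  ss_refl : forall s, inc n s -> R s s;
  ss_sym : forall s t, inc n s -> inc n t -> R s t -> R t s;
  ss_trans : forall s t u, inc n s -> inc n t -> inc n u ->
    R s t -> R t u -> R s u;
  ss_congr : forall s t s' t', inc n s -> inc n t -> inc n s' -> inc n t' ->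
    R s s' -> R t t' -> A s t -> A s' t';
  ss_irrefl : forall s, inc n s -> ~ A s s;
  ss_shift : forall s, inc n.+1 s -> A s (s \o S) }.

Lemma inc_le d (T : porderType d) m n (s : nat -> T) :
  (m <= n)%N -> inc n s -> inc m s.
Proof. by move=> mn sI i j ij jm; apply: sI => //; apply: leq_trans mn. Qed.

Lemma inc_shift d (T : porderType d) n (s : nat -> T) :
  inc n.+1 s -> inc n (s \o S).
Proof. by move=> sI i j ij jn; apply: sI. Qed.

Lemma inc_lt d (T : porderType d) n (s : nat -> T) i j : inc n s ->
  (i < n)%N -> (j < n)%N -> (s i < s j)%O = (i < j)%N.
Proof.
move=> sI ilt jlt; case: (ltngtP i j) => [ij|ji|->]; first exact: sI.
- by apply/negbTE/negP => /lt_trans/(_ (sI _ _ ji ilt)); rewrite ltxx.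
- exact: ltxx.
Qed.

Lemma ss_agree n R A s t : shift_system n R A -> inc n s -> inc n t ->
  (forall i, (i < n)%N -> s i = t i) -> R s t.
Proof.
move=> H sI tI st; apply: (ss_pattern H sI sI sI tI _ (ss_refl H sI)).
by move=> i j ilt jlt; rewrite -!st.
Qed.

(** Used for maps [e] that fill in a coordinate on which classes do not depend. *)
Lemma ss_pullback n m R A (e : (nat -> int) -> nat -> int) :
  shift_system n R A ->
  (forall s, inc m s -> inc n (e s)) ->
  (forall s t s' t', inc m s -> inc m t -> inc m s' -> inc m t' ->
    same_pattern m s t s' t' -> R (e s) (e t) -> R (e s') (e t')) ->
  (forall s, inc m.+1 s -> A (e s) (e (s \o S))) ->
  shift_system m (fun s t => R (e s) (e t)) (fun s t => A (e s) (e t)).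
Proof.
move=> H eI ep es; split=> //.
- by move=> s sI; apply: (ss_refl H); apply: eI.
- by move=> s t sI tI; apply: (ss_sym H); apply: eI.
- by move=> s t u sI tI uI; apply: (ss_trans H); apply: eI.
- by move=> s t s' t' sI tI sI' tI'; apply: (ss_congr H); apply: eI.
- by move=> s sI; apply: (ss_irrefl H); apply: eI.
Qed.

Definition cons_fun (c : int) (s : nat -> int) : nat -> int :=
  fun i => if i is j.+1 then s j else c.

Definition rcons_fun n (c : int) (s : nat -> int) : nat -> int :=
  fun i => if (i < n)%N then s i else c.

Lemma inc_cons n c s : inc n s -> (0 < n -> c < s 0%N)%O ->
  inc n.+1 (cons_fun c s).
Proof.
move=> sI cs [|i] [|j] //= ij; rewrite ltnS => jn; last exact: sI.
apply: (@lt_le_trans _ _ (s 0)); first by apply: cs; lia.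
by case: j {ij} jn => // j jn; apply: ltW; apply: sI.
Qed.

Lemma inc_rcons n c s : inc n s -> (0 < n -> s n.-1 < c)%O ->
  inc n.+1 (rcons_fun n c s).
Proof.
move=> sI cs i j ij; rewrite ltnS => jn; rewrite /rcons_fun.
rewrite (leq_trans ij jn); case: ifP => [jn'|/negbT]; first exact: sI.
move=> nj; have {nj jn} jE : j = n by lia.
apply: (@le_lt_trans _ _ (s n.-1)); last by apply: cs; lia.
have [->//|ne] := eqVneq i n.-1; apply: ltW; apply: sI; lia.
Qed.

(* If two equivalent tuples differ in their first entry, then the smaller of
   these two entries can be moved without changing the pattern, so that the
   class of a tuple does not depend on its first entry at all. *)
Lemma ss_drop_first n R A s t : shift_system n.+1 R A ->
  inc n.+1 s -> inc n.+1 t -> R s t -> s 0%N <> t 0%N ->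
  forall u v, inc n.+1 u -> inc n.+1 v -> (forall i, (0 < i <= n)%N -> u i = v i) ->
  R u v.
Proof.
move=> H.
have sym := ss_sym H; have tr := ss_trans H.
wlog lt_st : s t / (s 0%N < t 0%N)%O.
  move=> W sI tI Rst ne; case: (ltgtP (s 0%N) (t 0%N)) => // lt.
    exact: (W s t).
  by apply: (W t s) => //; [apply: sym|apply: nesym].
move=> sI tI Rst _ u v uI vI.
wlog lt_uv : u v uI vI / (u 0%N < v 0%N)%O.
  move=> W uv; case: (ltgtP (u 0%N) (v 0%N)) => lt.
  - exact: (W u v).
  - by apply: sym => //; apply: (W v u) => // i ?; rewrite uv.
  - by apply: (ss_agree H) => // -[|i] ilt; [|apply: uv].
(* Lowering the smaller first entry changes no comparison with [t], so [s'] is equivalent to [t] and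
   thus to [s]. The pair [s', s] has the pattern of [u, v]. *)
move=> uv; pose s' := cons_fun (s 0%N - 1)%R (s \o S).
have s'I : inc n.+1 s'.
  apply: inc_cons; first exact: inc_shift.
  by move=> n0; have := sI 0%N 1%N isT n0; rewrite /=; lia.
have le0 (w : nat -> int) i : inc n.+1 w -> (i < n.+1)%N -> (w 0%N <= w i)%O.
  by case: i => // i wI ilt; apply: ltW; apply: wI.
apply: (ss_pattern H s'I sI uI vI); last first.
  apply: (tr _ t) => //; last exact: sym.
  apply: (ss_pattern H sI tI s'I tI) Rst => -[|i] j ilt jlt //=.
  by have := le0 t j tI jlt; lia.
move=> [|i] [|j] ilt jlt /=.
- by split; lia.
- rewrite -uv ?jlt //; have := sI 0%N j.+1 isT jlt; have := uI 0%N j.+1 isT jlt.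
  by split; lia.
- rewrite uv ?ilt //; have := sI 0%N i.+1 isT ilt; have := vI 0%N i.+1 isT ilt.
  by split; lia.
- by rewrite -(uv j.+1) ?jlt // !(inc_lt sI) ?(inc_lt uI).
Qed.

(** Mirror image of [ss_drop_first]: the larger of the two last entries is raised. *)
Lemma ss_drop_last n R A s t : shift_system n.+1 R A ->
  inc n.+1 s -> inc n.+1 t -> R s t -> s n <> t n ->
  forall u v, inc n.+1 u -> inc n.+1 v -> (forall i, (i < n)%N -> u i = v i) ->
  R u v.
Proof.
move=> H.
have sym := ss_sym H; have tr := ss_trans H.
wlog lt_st : s t / (t n < s n)%O.
  move=> W sI tI Rst ne; case: (ltgtP (s n) (t n)) => // lt.
    by apply: (W t s) => //; [apply: sym|apply: nesym].
  exact: (W s t).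
move=> sI tI Rst _ u v uI vI.
wlog lt_uv : u v uI vI / (v n < u n)%O.
  move=> W uv; case: (ltgtP (u n) (v n)) => lt.
  - by apply: sym => //; apply: (W v u) => // i ?; rewrite uv.
  - exact: (W u v).
  - apply: (ss_agree H) => // i; rewrite ltnS leq_eqVlt => /orP[/eqP->//|].
    exact: uv.
move=> uv; pose s' := rcons_fun n (s n + 1)%R s.
have s'I : inc n.+1 s'.
  apply: inc_rcons; first exact: inc_le sI.
  by move=> n0; have := sI n.-1 n; lia.
have len (w : nat -> int) i : inc n.+1 w -> (i < n.+1)%N -> (w i <= w n)%O.
  move=> wI; rewrite ltnS leq_eqVlt => /orP[/eqP->//|ilt].
  by apply: ltW; apply: wI.
have s'n : s' n = (s n + 1)%R by rewrite /s' /rcons_fun ltnn.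
have s'i i : (i < n)%N -> s' i = s i by rewrite /s' /rcons_fun => ->.
have lastP i : (i < n.+1)%N -> i = n \/ (i < n)%N by lia.
apply: (ss_pattern H s'I sI uI vI); last first.
  apply: (tr _ t) => //; last exact: sym.
  apply: (ss_pattern H sI tI s'I tI) Rst => i j /lastP[->|ilt] jlt.
    by rewrite s'n; have := len t j tI jlt; lia.
  by rewrite s'i.
move=> i j /lastP[->|ilt] /lastP[->|jlt].
- by rewrite s'n; split; lia.
- rewrite s'n -uv //; have := sI j n jlt (ltnSn n); have := uI j n jlt (ltnSn n).
  by split; lia.
- rewrite s'i // uv //; have := sI i n ilt (ltnSn n); have := vI i n ilt (ltnSn n).
  by split; lia.
- by rewrite s'i // -(uv j) // !(inc_lt sI) ?(inc_lt uI) // ltnW.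
Qed.

(** For [a < b] the number [b * b + a] lies between the squares of [b] and [b + 1], so it is an
    increasing code of a pair of consecutive entries. *)
Definition window (s : nat -> nat) : nat -> nat :=
  fun i => (s i.+1 * s i.+1 + s i)%N.

Lemma inc_window n s : inc n.+1 s -> inc n (window s).
Proof.
move=> sI i j ij jn; have := sI i j ij (leqW jn); have := sI i.+1 j.+1 ij jn.
by rewrite !ltEnat /= /window; nia.
Qed.

Lemma window_inj n s t i : inc n.+1 s -> inc n.+1 t -> (i < n)%N ->
  window s i = window t i -> s i = t i /\ s i.+1 = t i.+1.
Proof.
move=> sI tI ilt; have := sI i i.+1 (ltnSn i) ilt; have := tI i i.+1 (ltnSn i) ilt.
rewrite !ltEnat /window /= => lt_t lt_s.
by case: (ltngtP (s i.+1) (t i.+1)) => [lt|lt|->] E; [nia|nia|split=> //; lia].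
Qed.

Lemma inc_iter_window k n s : inc (n + k) s -> inc n (iter k window s).
Proof.
elim: k n => [|k IH] n; first by rewrite addn0.
by rewrite addnS -addSn => /IH /inc_window.
Qed.

Lemma iter_window_shift k s : iter k window (s \o S) = iter k window s \o S.
Proof. by elim: k => //= k ->. Qed.

(** Each round lengthens by one the block of entries of [s] coded by entry [i]. *)
Lemma iter_window_inj k n s t i : inc (n + k) s -> inc (n + k) t -> (i < n)%N ->
  iter k window s i = iter k window t i ->
  forall j, (j <= k)%N -> s (i + j)%N = t (i + j)%N.
Proof.
elim: k s t => [|k IH] s t sI tI ilt E j; first by rewrite leqn0 => /eqP->; rewrite addn0.
move: E; rewrite !iterSr => E; rewrite addnS in sI tI.
have E' := IH _ _ (inc_window sI) (inc_window tI) ilt E.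
have E'' l : (l <= k)%N -> s (i + l)%N = t (i + l)%N /\ s (i + l).+1 = t (i + l).+1.
  by move=> lk; apply: (window_inj sI tI _ (E' l lk)); lia.
rewrite leq_eqVlt => /orP[/eqP->|]; last by rewrite ltnS => /E''[].
by rewrite addnS; have [] := E'' k (leqnn k).
Qed.

Lemma iter_window_agree k n s t : (forall i, (i < n + k)%N -> s i = t i) ->
  forall i, (i < n)%N -> iter k window s i = iter k window t i.
Proof.
elim: k s t => [|k IH] s t st i ilt; first by apply: st; rewrite addn0.
by rewrite !iterSr; apply: IH ilt => j jlt; rewrite /window !st //; lia.
Qed.

(* Coordinates on which the class of a tuple does not depend are dropped from
   both ends.  Once the first and the last coordinate are determined by the
   class, replacing each entry by a code of a long window starting there makes
   the whole tuple determined by its class. *)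
Lemma shift_system_inj n R A : shift_system n R A ->
  exists2 m, (0 < m)%N & exists G : (nat -> nat) -> nat -> int,
    [/\ forall s, inc m s -> inc n (G s),
        forall s t, inc m s -> inc m t ->
          R (G s) (G t) <-> forall i, (i < m)%N -> s i = t i &
        forall s, inc m.+1 s -> A (G s) (G (s \o S))].
Proof.
elim: n R A => [|n IH] R A H.
  have I0 (s : nat -> int) : inc 0 s by [].
  have s1 : inc 1 Posz by move=> [|i] [|j].
  (* All empty tuples are equivalent, so a shift edge would be a loop. *)
  exfalso; apply: (ss_irrefl H (I0 Posz)).
  by apply: (ss_congr H _ _ _ _ _ _ (ss_shift H s1)) => //; apply: (ss_agree H).
case: (pselect (exists s t, [/\ inc n.+1 s, inc n.+1 t, R s t & s 0%N <> t 0%N])).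
  move=> [s0 [t0 [s0I t0I R0 ne]]]; have drop := ss_drop_first H s0I t0I R0 ne.
  pose e s := cons_fun (s 0%N - 1)%R s.
  have eI s : inc n s -> inc n.+1 (e s) by move=> sI; apply: inc_cons => //; lia.
  have [||m m0 [G [GI GR GS]]] := IH _ _ (@ss_pullback n.+1 n R A e H eI _ _).
  - move=> s t s' t' sI tI sI' tI' pat Re.
    (* The pattern of [s, t] does not determine how the entries added by [e] compare with the other
       tuple. They are replaced by a common value below both tuples, which keeps the classes. *)
    pose c s t : int := (Order.min (s 0%N) (t 0%N) - 1)%R.
    have cI (s1 t1 : nat -> int) : inc n s1 ->
        inc n.+1 (cons_fun (c s1 t1) s1) /\ inc n.+1 (cons_fun (c t1 s1) s1).
      by move=> s1I; split; apply: inc_cons => // _; rewrite /c; lia.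
    have cR (s1 t1 : nat -> int) : inc n s1 -> 
        R (e s1) (cons_fun (c s1 t1) s1).
      by move=> s1I; apply: drop; [exact: eI|exact: (cI _ _ s1I).1|case].
    have cC (s1 t1 : nat -> int) : c s1 t1 = c t1 s1 by rewrite /c minC.
    have [sc _] := cI s t sI; have [_ tc] := cI t s tI.
    have [sc' _] := cI s' t' sI'; have [_ tc'] := cI t' s' tI'.
    apply: (ss_trans H (eI _ sI') sc' (eI _ tI') (cR _ _ sI')).
    apply: (ss_trans H sc' tc' (eI _ tI')); last first.
      by apply: (ss_sym H (eI _ tI') tc'); rewrite cC; apply: cR.
    apply: (ss_pattern H sc tc sc' tc'); last first.
      apply: (ss_trans H sc (eI _ sI) tc); first exact: (ss_sym H (eI _ sI) sc (cR _ _ sI)).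
      by apply: (ss_trans H (eI _ sI) (eI _ tI) tc Re); rewrite cC; apply: cR.
    have lec (s1 t1 : nat -> int) j : inc n s1 -> inc n t1 -> (j < n)%N ->
        (c s1 t1 < s1 j)%O /\ (c s1 t1 < t1 j)%O.
      move=> s1I t1I jn; have le0 (w : nat -> int) : inc n w -> (w 0%N <= w j)%O.
        by case: j jn => // j jn wI; apply: ltW; apply: wI.
      by have := le0 s1 s1I; have := le0 t1 t1I; rewrite /c; split; lia.
    move=> [|i] [|j] ilt jlt /=; last exact: pat.
    + by rewrite !ltxx.
    + by have [_ ?] := lec s t j sI tI jlt; have [_ ?] := lec s' t' j sI' tI' jlt; split; lia.
    + by have [? _] := lec s t i sI tI ilt; have [? _] := lec s' t' i sI' tI' ilt; split; lia.
  - move=> s sI; have sI' := inc_le (leqnSn n) sI.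
    (* The shift of [e s] is [s], which differs from [e (s \o S)] only in the irrelevant first
       entry. *)
    have wI : inc n.+2 (e s) by apply: inc_cons => //; lia.
    apply: (ss_congr H _ _ _ _ _ _ (ss_shift H wI)).
    + exact: eI.
    + exact: sI.
    + exact: eI.
    + by apply: eI; apply: inc_shift.
    + exact: (ss_refl H (eI _ sI')).
    + by apply: drop => //; [apply: eI; apply: inc_shift|case].
  - by exists m => //; exists (e \o G); split=> // s /GI /eI.
move=> noR1; have N1 s t : inc n.+1 s -> inc n.+1 t -> R s t -> s 0%N = t 0%N.
  by move=> sI tI Rst; apply: contrapT => ne; apply: noR1; exists s, t.
case: (pselect (exists s t, [/\ inc n.+1 s, inc n.+1 t, R s t & s n <> t n])).
  move=> [s0 [t0 [s0I t0I R0 ne]]]; have drop := ss_drop_last H s0I t0I R0 ne.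
  pose e s := rcons_fun n (s n.-1 + 1)%R s.
  have eI s : inc n s -> inc n.+1 (e s) by move=> sI; apply: inc_rcons => //; lia.
  have [||m m0 [G [GI GR GS]]] := IH _ _ (@ss_pullback n.+1 n R A e H eI _ _).
  - move=> s t s' t' sI tI sI' tI' pat Re.
    pose c s t : int := (Order.max (s n.-1) (t n.-1) + 1)%R.
    have cI (s1 t1 : nat -> int) : inc n s1 ->
        inc n.+1 (rcons_fun n (c s1 t1) s1) /\ inc n.+1 (rcons_fun n (c t1 s1) s1).
      by move=> s1I; split; apply: inc_rcons => // _; rewrite /c; lia.
    have cR (s1 t1 : nat -> int) : inc n s1 -> 
        R (e s1) (rcons_fun n (c s1 t1) s1).
      move=> s1I; apply: drop; [exact: eI|exact: (cI _ _ s1I).1|].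
      by move=> i ilt; rewrite /e /rcons_fun ilt.
    have cC (s1 t1 : nat -> int) : c s1 t1 = c t1 s1 by rewrite /c maxC.
    have [sc _] := cI s t sI; have [_ tc] := cI t s tI.
    have [sc' _] := cI s' t' sI'; have [_ tc'] := cI t' s' tI'.
    apply: (ss_trans H (eI _ sI') sc' (eI _ tI') (cR _ _ sI')).
    apply: (ss_trans H sc' tc' (eI _ tI')); last first.
      by apply: (ss_sym H (eI _ tI') tc'); rewrite cC; apply: cR.
    apply: (ss_pattern H sc tc sc' tc'); last first.
      apply: (ss_trans H sc (eI _ sI) tc); first exact: (ss_sym H (eI _ sI) sc (cR _ _ sI)).
      by apply: (ss_trans H (eI _ sI) (eI _ tI) tc Re); rewrite cC; apply: cR.
    have lec (s1 t1 : nat -> int) j : inc n s1 -> inc n t1 -> (j < n)%N ->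
        (s1 j < c s1 t1)%O /\ (t1 j < c s1 t1)%O.
      move=> s1I t1I jn; have le0 (w : nat -> int) : inc n w -> (w j <= w n.-1)%O.
        by have [->//|ne'] := eqVneq j n.-1; move=> wI; apply: ltW; apply: wI; lia.
      by have := le0 s1 s1I; have := le0 t1 t1I; rewrite /c; split; lia.
    move=> i j ilt jlt; rewrite /rcons_fun.
    case: ifP => i1; case: ifP => j1; [exact: pat| | |by rewrite !ltxx].
    + by have [? _] := lec s t i sI tI i1; have [? _] := lec s' t' i sI' tI' i1; split; lia.
    + by have [_ ?] := lec s t j sI tI j1; have [_ ?] := lec s' t' j sI' tI' j1; split; lia.
  - move=> s sI; have sI' := inc_le (leqnSn n) sI.
    pose w := rcons_fun n.+1 (s n + 1)%R s.
    have wI : inc n.+2 w by apply: inc_rcons => //= _; lia.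
    have wE i : (i < n.+1)%N -> w i = s i by rewrite /w /rcons_fun => ->.
    have wI' := inc_le (leqnSn _) wI; have wI'' := inc_shift wI.
    have I2 := eI _ (inc_shift sI).
    apply: (ss_congr H wI' wI'' (eI _ sI') I2 _ _ (ss_shift H wI)).
    + by apply: drop => // [|i ilt]; [exact: eI|rewrite wE ?/e /rcons_fun ?ilt //; lia].
    + by apply: drop => // i ilt; rewrite /= wE /e /rcons_fun ?ilt.
  - by exists m => //; exists (e \o G); split=> // s /GI /eI.
move=> noR2; have N2 s t : inc n.+1 s -> inc n.+1 t -> R s t -> s n = t n.
  by move=> sI tI Rst; apply: contrapT => ne; apply: noR2; exists s, t.
(* After [n+1] rounds of [window] the first entry codes the entries 0 to [n+1] of [s] and the last
   one the entries [n] to [2n+1]; together these are all [2n+2] entries. *)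
exists (n.+1 + n.+1)%N => //.
exists (fun s i => Posz (iter n.+1 window s i)); have GI s :
    inc (n.+1 + n.+1) s -> inc n.+1 (fun i => Posz (iter n.+1 window s i)).
  by move=> /inc_iter_window sI i j ij jn; have := sI i j ij jn; rewrite ltEnat.
split=> // [s t sI tI|s sI]; last first.
  rewrite iter_window_shift; apply: (ss_shift H (s := fun i => Posz (iter n.+1 window s i))).
  by move: sI; rewrite -addSn => /inc_iter_window sI i j ij jn; have := sI i j ij jn; rewrite ltEnat.
split=> [RG i ilt|st]; last first.
  apply: (ss_agree H) => [||i ilt]; [exact: GI|exact: GI|].
  by congr Posz; apply: iter_window_agree ilt.
have [E0] := N1 _ _ (GI _ sI) (GI _ tI) RG.
have [En] := N2 _ _ (GI _ sI) (GI _ tI) RG.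
case: (leqP i n.+1) => [ile|igt].
  exact: (iter_window_inj sI tI _ E0 ile).
have := iter_window_inj sI tI (ltnSn n) En (j := (i - n)%N).
by rewrite subnKC; [apply|]; lia.
Qed.

(** * Graphs on functions given by a single order type *)

Definition same_order (Y : Type) d1 (O1 : porderType d1) d2 (O2 : porderType d2)
    (h1 : Y -> O1) (h2 : Y -> O2) : Prop :=
  forall y z, (h1 y < h1 z)%O = (h2 y < h2 z)%O.

(** Turns a pair of functions into one, so that [same_order] also compares order types of pairs. *)
Definition join_fun (X O : Type) (f g : X -> O) : X + X -> O :=
  fun s => match s with inl x => f x | inr x => g x end.

Section SameOrder.
Variables (Y : Type) (d1 : Order.disp_t) (O1 : orderType d1).
Variables (d2 : Order.disp_t) (O2 : orderType d2).
Variables (h1 : Y -> O1) (h2 : Y -> O2).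
Hypothesis h12 : same_order h1 h2.

Lemma same_order_le y z : (h1 y <= h1 z)%O = (h2 y <= h2 z)%O.
Proof. by rewrite !leNgt h12. Qed.

Lemma same_order_eq y z : (h1 y == h1 z) = (h2 y == h2 z).
Proof. by rewrite !eq_le !same_order_le. Qed.

End SameOrder.

(** * Colouring by comparison of drifting blocks *)

Section Drift.
Variables (T : Type) (d : Order.disp_t) (O : orderType d).
Variables (D : T -> T -> Prop) (b : T -> nat -> nat -> O).
Hypothesis b_inc : forall f g n k, D f g -> (k < n)%N ->
  (b f n k < b f n k.+1)%O /\ (b g n k < b g n k.+1)%O.
Hypothesis b_le : forall f g n k, D f g -> (k < n)%N -> (b f n k.+1 <= b g n k)%O.
Hypothesis b_lt : forall f g n k, D f g -> (k.+2 <= n)%N -> (b g n k < b f n k.+2)%O.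

Let near w f g := forall n k, (k + 2 * w <= n)%N ->
  (b f n k <= b g n (k + 2 * w))%O /\ (b g n k <= b f n (k + 2 * w))%O.

(* Along a walk of length [w] indices drift by at most [2w], whereas the blocks
   are arbitrarily long.  Comparing each block with that of a fixed member of
   the connected component therefore gives a colouring. *)
Lemma drift_colouring :
  exists c : T -> set (nat * nat * nat), forall f g, D f g -> c f <> c g.
Proof.
pose conn f g := exists w, near w f g.
have conn_sym f g : conn f g -> conn g f.
  by move=> [w fg]; exists w => n k /fg[].
have conn_trans f g h : conn f g -> conn g h -> conn f h.
  move=> [w fg] [w' gh]; exists (w + w')%N => n k kn.
  have E1 : (k + 2 * w + 2 * w' = k + 2 * (w + w'))%N by lia.
  have E2 : (k + 2 * w' + 2 * w = k + 2 * (w + w'))%N by lia.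
  have [fg1 _] := fg n k ltac:(lia); have [gh1 _] := gh n (k + 2 * w)%N ltac:(lia).
  have [_ hg1] := gh n k ltac:(lia); have [_ gf1] := fg n (k + 2 * w')%N ltac:(lia).
  by rewrite -{1}E1 -E2; split; [apply: le_trans gh1|apply: le_trans gf1].
have conn_refl f : conn f f by exists 0 => n k _; rewrite muln0 addn0.
have conn_D f g : D f g -> conn f g.
  move=> fg; exists 1 => n k kn; rewrite muln1 addn2; split; last first.
    by apply: ltW; apply: b_lt => //; lia.
  apply: le_trans (ltW (b_inc fg _).1) _; first by lia.
  apply: le_trans (b_le fg _) _; first by lia.
  have [_ lt1] := b_inc fg (n := n) (k := k) ltac:(lia).
  have [_ lt2] := b_inc fg (n := n) (k := k.+1) ltac:(lia).
  exact: ltW (lt_trans lt1 lt2).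
(* [c f] is a fixed member of the component of [f]. *)
have [c [cE cc]] : exists c : T -> T,
    (forall f, conn f (c f)) /\ (forall f g, conn f g -> c f = c g).
  have /choice[pick pickP] (P : set T) : exists o, forall x, P x -> exists2 y, o = Some y & P y.
    case: (pselect (exists x, P x)) => [[x Px]|nP]; first by exists (Some x) => _ _; exists x.
    by exists None => x Px; case: nP; exists x.
  exists (fun f => odflt f (pick (conn f))); split=> [f|f g fg].
    by have [h -> /=] := pickP _ f (conn_refl f).
  have -> : conn f = conn g.
    apply/funext => h; apply/propext; split; last exact: conn_trans.
    by apply: conn_trans; apply: conn_sym.
  by have [h -> /=] := pickP _ g (conn_refl g).
(* The colour records which entries of the blocks of [f] bound which entries of the blocks of
   [c f]. *)
exists (fun f => [set p | b (c f) p.1.1 p.1.2 <= b f p.1.1 p.2]%O) => f g fg E.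
have cfg := cc _ _ (conn_D _ _ fg); have [w fw] := cE f.
(* Chosen with [m + 2w = n] and [1 + 2w = m], so that nearness gives [z <= b f n n] and
   [b f n 1 <= z]. *)
pose n := (4 * w).+1; pose m := (2 * w).+1; pose z := b (c f) n m.
(* A bound of [z] at one index of [f] passes to [g] at the index before, and back to [f] there by
   equality of colours. It descends to index 0, contradicting [b f n 0 < b f n 1 <= z]. *)
have low k : (k <= n)%N -> (z <= b f n (n - k))%O.
  elim: k => [_|k IH kn].
    rewrite subn0; have := (fw n m _).2; rewrite /n /m.
    have -> : ((2 * w).+1 + 2 * w = (4 * w).+1)%N by lia.
    by apply.
  have {IH} := IH (ltnW kn).
  have -> : (n - k)%N = (n - k.+1).+1 by lia.
  move=> /le_trans/(_ (b_le fg _)) zg.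
  have : [set p | b (c g) p.1.1 p.1.2 <= b g p.1.1 p.2]%O (n, m, (n - k.+1)%N).
    by rewrite /= -cfg; apply: zg; lia.
  by rewrite -E.
have := low n (leqnn n); rewrite subnn leNgt => /negP; apply.
apply: lt_le_trans (b_inc fg _).1 _; first by lia.
by have := (fw n 1 _).1; rewrite add1n; apply; lia.
Qed.

End Drift.

(** The colour of [f] is the set of lengths of walks from [f]. Walks from [g] extend to longer ones
    from [f], so equal colours on an edge would give walks of every length. Triples are used to
    share the palette of [drift_colouring]. *)
Lemma walk_or_colouring (T : Type) (D : T -> T -> Prop) :
  (exists c : T -> set (nat * nat * nat), forall f g, D f g -> c f <> c g) \/
  (forall n, exists w : nat -> T, forall k, (k < n)%N -> D (w k) (w k.+1)).
Proof.
pose walk n f := exists2 w : nat -> T, w 0 = f & forall k, (k < n)%N -> D (w k) (w k.+1).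
case: (pselect (forall n, exists f, walk n f)) => [W|/existsNP[n nW]].
  by right=> n; have [f [w _ wD]] := W n; exists w.
left; exists (fun f => [set p | walk p.1.1 f]) => f g fg E.
suff W m : walk m f by apply: nW; exists f; apply: W.
elim: m => [|m]; first by exists (fun=> f).
move=> Wf; have : [set p | walk p.1.1 f] (m, 0, 0)%N by [].
rewrite E => -[w w0 wD]; exists (fun k => if k is k'.+1 then w k' else f) => //.
by case=> [|k] kn; [rewrite w0|apply: wD].
Qed.

(** * Iterated steps between two functions, their limits and ranks *)

Section Step.
Variables (X : Type) (d : Order.disp_t) (O : orderType d).
Hypothesis wO : is_ordinal O.
Variables o f g : X -> O.
Hypotheses (fo : same_order f o) (go : same_order g o).

Lemma step_ex x : exists y,
  ((f x <= g x)%O -> (f x <= g y)%O /\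
     forall z, (f x <= g z)%O -> (o y <= o z)%O) /\
  (~~ (f x <= g x)%O -> y = x).
Proof.
case: (boolP (f x <= g x)%O) => [le|_]; last by exists x.
have [_ [y ley <-] ymin] : exists2 a, (exists2 y, (f x <= g y)%O & o y = a) &
    forall b, (exists2 y, (f x <= g y)%O & o y = b) -> (a <= b)%O.
  by apply: wo_min => //; exists (o x), x.
by exists y; split=> // _; split=> // z xz; apply: ymin; exists z.
Qed.

(* The least index whose value under [g] bounds [f x] if [f x <= g x], and [x]
   itself otherwise. *)
Definition step : X -> X := projT1 (choice step_ex).

Let fle x y : (f x <= f y)%O = (o x <= o y)%O. Proof. exact: same_order_le fo x y. Qed.
Let gle x y : (g x <= g y)%O = (o x <= o y)%O. Proof. exact: same_order_le go x y. Qed.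

Lemma step_up x : (f x <= g x)%O -> (f x <= g (step x))%O.
Proof. by move=> le; have [/(_ le)[]] := projT2 (choice step_ex) x. Qed.

Lemma step_min x z : (f x <= g x)%O -> (f x <= g z)%O -> (o (step x) <= o z)%O.
Proof. by move=> le lez; have [/(_ le)[_ H _]] := projT2 (choice step_ex) x; apply: H. Qed.

Lemma step_id x : (g x < f x)%O -> step x = x.
Proof. by rewrite ltNge => gt; have [_ /(_ gt)] := projT2 (choice step_ex) x. Qed.

Lemma step_le x : (o (step x) <= o x)%O.
Proof.
by case: (leP (f x) (g x)) => [le|/step_id->//]; apply: step_min.
Qed.

Lemma step_mono x y : (f x <= g x)%O -> (f y <= g y)%O ->
  (o x <= o y)%O -> (o (step x) <= o (step y))%O.
Proof.
move=> lex ley xy; apply: step_min => //; apply: le_trans (step_up ley).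
by rewrite fle.
Qed.

Lemma same_class x y : o x = o y -> (f x < g x)%O = (f y < g y)%O.
Proof.
move=> E; have -> : f x = f y by apply/eqP; rewrite (same_order_eq fo) E.
by have -> : g x = g y by apply/eqP; rewrite (same_order_eq go) E.
Qed.

Lemma step_eq x y : o x = o y -> o (step x) = o (step y).
Proof.
move=> E; have Ef : f x = f y by apply/eqP; rewrite (same_order_eq fo) E.
have Eg : g x = g y by apply/eqP; rewrite (same_order_eq go) E.
case: (leP (f x) (g x)) => [le|lt].
  have le' : (f y <= g y)%O by rewrite -Ef -Eg.
  by apply/eqP; rewrite eq_le !step_mono // E.
by rewrite !step_id // -?Ef -?Eg.
Qed.

Lemma iter_step_le j k x : (j <= k)%N -> (o (iter k step x) <= o (iter j step x))%O.
Proof.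
move=> /subnK<-; elim: (k - j)%N => // i IH.
by rewrite addSn /=; apply: le_trans (step_le _) IH.
Qed.

Lemma iter_step_eq k x y : o x = o y -> o (iter k step x) = o (iter k step y).
Proof. by move=> E; elim: k => //= k IH; apply: step_eq. Qed.

(* Failure of uniform stabilisation yields the blocks of [drift_colouring]. *)
Lemma long_blocks : (forall n, exists x, o (iter n step x) <> o (iter n.+1 step x)) ->
  exists y : nat -> nat -> X, forall n,
    [/\ forall k, (k < n)%N -> (o (y n k) < o (y n k.+1))%O,
        forall k, (k < n)%N -> (f (y n k.+1) <= g (y n k))%O &
        forall k, (k.+2 <= n)%N -> (g (y n k) < f (y n k.+2))%O].
Proof.
move=> /choice[x xP]; exists (fun n k => iter (n - k) step (x n)) => n.
(* Had the iterates stopped at stage [k <= n], they would also have stopped at stage [n]. *)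
have lt k : (k <= n)%N -> (o (iter k.+1 step (x n)) < o (iter k step (x n)))%O.
  move=> kn; rewrite lt_neqAle (iter_step_le _ (leqnSn k)) andbT; apply/eqP => E.
  case: (xP n); suff H j : o (iter (j + k).+1 step (x n)) = o (iter (j + k) step (x n)).
    by have := H (n - k)%N; rewrite subnK.
  by elim: j => [|j IH]; [exact: E|rewrite addSn; exact: step_eq IH].
have up k : (k <= n)%N -> (f (iter k step (x n)) <= g (iter k step (x n)))%O.
  move=> /lt; rewrite /= => ltk; rewrite leNgt; apply/negP => /step_id E.
  by rewrite E ltxx in ltk.
have subE k : (k < n)%N -> (n - k)%N = (n - k.+1).+1 by lia.
split=> k kn.
- by rewrite (subE k) //; apply: lt; lia.
- by rewrite (subE k) //=; apply: step_up; apply: up; lia.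
- have -> : (n - k)%N = (n - k.+2).+2 by lia.
  (* Otherwise minimality would bound one step by two steps, against the strict decrease. *)
  rewrite ltNge; apply/negP => le.
  have := step_min (up (n - k.+2)%N ltac:(lia)) le; rewrite leNgt => /negP; apply.
  by apply: (lt (n - k.+2).+1); lia.
Qed.

Variable n : nat.
Hypothesis stab : forall x, o (iter n step x) = o (iter n.+1 step x).

Let e x := iter n step x.
Let up x := (f x < g x)%O.

Lemma up_step x : up x -> up (step x).
Proof.
rewrite /up => lt; have := step_le x; rewrite le_eqVlt => /orP[/eqP/same_class->//|].
by rewrite -fo => /lt_le_trans; apply; apply: step_up; apply: ltW.
Qed.

Lemma up_iter k x : up x -> up (iter k step x).
Proof. by move=> ux; elim: k => //= k; apply: up_step. Qed.

Lemma iter_step_mono k x y : up x -> up y -> (o x <= o y)%O ->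
  (o (iter k step x) <= o (iter k step y))%O.
Proof.
by move=> ux uy xy; elim: k => //= k IH; apply: step_mono => //; apply/ltW/up_iter.
Qed.

Lemma last_step x : o (e (step x)) = o (e x).
Proof. by rewrite /e -iterSr -stab. Qed.

(** Some [k] has [z] above the iterate [k+1] of [y] and not above the iterate [k]. Then [f z <= f
    (iter k step y) <= g (iter k.+1 step y) < g z]. *)
Lemma up_between y z : up y -> (o (e y) < o z)%O -> (o z <= o y)%O -> up z.
Proof.
rewrite /e => uy; elim: n => [|k IH] /=.
  by move=> /lt_le_trans/[apply]; rewrite ltxx.
move=> lt le; case: (ltP (o (iter k step y)) (o z)) => [/IH->//|le'].
have /step_up := ltW (up_iter k uy); rewrite -fle in le' => /(le_trans le').
by move=> /le_lt_trans; apply; rewrite go.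
Qed.

(** Minimality puts [step y] below or at [x], and one more step does not change the limit [e y]. *)
Lemma up_linked x y : (o x < o y)%O -> (f y <= g x)%O ->
  [/\ up x, up y & (o (e y) <= o (e x))%O].
Proof.
move=> xy yx; have ux : up x by rewrite /up; apply: lt_le_trans yx; rewrite fo.
have uy : up y by rewrite /up; apply: le_lt_trans yx _; rewrite go.
split=> //; rewrite -(last_step y); apply: iter_step_mono => //.
  exact: up_step.
by apply: step_min => //; apply: ltW.
Qed.

Lemma rank_ex x : exists k, o (iter k step x) == o (e x).
Proof. by exists n. Qed.

Definition rank x := ex_minn (rank_ex x).

Lemma rank_le k x : o (iter k step x) = o (e x) -> (rank x <= k)%N.
Proof. by move=> /eqP; rewrite /rank; case: ex_minnP => m _; apply. Qed.

Lemma rankP x : o (iter (rank x) step x) = o (e x).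
Proof. by rewrite /rank; case: ex_minnP => m /eqP. Qed.

Lemma rank_max x : (rank x <= n)%N.
Proof. exact: rank_le. Qed.

Lemma rank_mono x y : up x -> up y -> o (e x) = o (e y) -> (o x <= o y)%O ->
  (rank x <= rank y)%N.
Proof.
move=> ux uy E xy; apply: rank_le; apply/eqP; rewrite eq_le.
apply/andP; split; last exact: iter_step_le (rank_max y).
by rewrite E -rankP; apply: iter_step_mono.
Qed.

Lemma rank_step_le x : (rank x <= (rank (step x)).+1)%N.
Proof. by apply: rank_le; rewrite iterSr rankP last_step. Qed.

Lemma rank_step_lt x : (0 < rank x)%N -> (rank (step x) < rank x)%N.
Proof.
case E : (rank x) => [//|k] _; rewrite ltnS; apply: rank_le.
by rewrite -iterSr -E rankP last_step.
Qed.

(** [f x <= g y] would put [step x] at or below [y], and a step lowers the rank by at most one.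
    Together with [rank_ngt] this leaves open only the case [rank x = (rank y).+1]. *)
Lemma rank_gt x y : up x -> up y -> o (e x) = o (e y) ->
  ((rank y).+1 < rank x)%N -> (g y < f x)%O.
Proof.
move=> ux uy E lt; rewrite ltNge; apply/negP => le.
have := rank_mono (up_step ux) uy; rewrite last_step => /(_ E).
move=> /(_ (step_min (ltW ux) le)); have := rank_step_le x; lia.
Qed.

(** [g y <= f x] would put [y] at or below [step x], whose rank is smaller than that of [x]. At rank
    0 both points are at the limit, and [g x = g y <= f x < g x]. *)
Lemma rank_ngt x y : up x -> up y -> o (e x) = o (e y) ->
  (rank x <= rank y)%N -> (f x < g y)%O.
Proof.
move=> ux uy E le; rewrite ltNge; apply/negP => yx.
have yu : (o y <= o (step x))%O.
  by rewrite -gle; apply: le_trans yx _; apply: step_up; apply: ltW.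
have := rank_mono uy (up_step ux); rewrite last_step => /(_ (esym E) yu) ryx.
have [r0|rp] := posnP (rank x); last by have := rank_step_lt rp; lia.
have xE : o x = o (e x) by rewrite -rankP r0.
have yE : o y = o x.
  apply/eqP; rewrite eq_le (le_trans yu (step_le x)) /= xE E.
  exact: (iter_step_le y (leq0n n)).
have : (g x < g x)%O.
  by rewrite -{1}(eqP (etrans (same_order_eq go y x) (introT eqP yE))); apply: le_lt_trans yx ux.
by rewrite ltxx.
Qed.

End Step.

Lemma lex3_lt d (O : orderType d) (a a' : O) (b b' : int) (c c' : O) :
  (((a, (b, c)) : O *l (int *l O)) < (a', (b', c')))%O =
  (a < a')%O || (a == a') && ((b < b')%O || (b == b') && (c < c')%O).
Proof.
by rewrite !ltEprodlexi /=; case: (ltgtP a a') => //= _; case: (ltgtP b b').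
Qed.

Lemma lex3_fst d (O : orderType d) (a a' : O) (p p' : int *l O) : (a < a')%O ->
  (((a, p) : O *l (int *l O)) < (a', p'))%O /\
  (((a', p') : O *l (int *l O)) < (a, p))%O = false.
Proof.
by move=> lt; rewrite !ltEprodlexi /= (ltW lt) [(a' <= a)%O]leNgt lt.
Qed.

(** * Functions built from integer tuples by ranks *)

Section Layers.
Variables (X : Type) (d : Order.disp_t) (O : orderType d).
Hypothesis wO : is_ordinal O.
Variables o f g : X -> O.
Hypotheses (fo : same_order f o) (go : same_order g o).

Let u := step wO o f g.
Let v := step wO o g f.

Variable n : nat.
Hypothesis ustab : forall x, o (iter n u x) = o (iter n.+1 u x).
Hypothesis vstab : forall x, o (iter n v x) = o (iter n.+1 v x).

Variable w : nat -> X -> O.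
Hypothesis w_o : forall k, (k <= n)%N -> same_order (w k) o.
Hypothesis w_fg : forall k x y, (k < n)%N ->
  (w k x < w k.+1 y)%O = (f x < g y)%O /\ (w k.+1 y < w k x)%O = (g y < f x)%O.

(** The limit of [x] in its direction of movement; points with [f x = g x] do not move. *)
Definition base x : X :=
  if (f x < g x)%O then iter n u x else if (g x < f x)%O then iter n v x else x.

Let ru := rank wO o f g n.
Let rv := rank wO o g f n.

(* The order type of [layered s] and its shift is that of [f] and [g]: on the
   part moving up, the value at [x] is governed by the entry of [s] indexed by
   the rank of [x]; on the part moving down, tuples are read in reverse. *)
Definition layered (s : nat -> int) (x : X) : O *l (int *l O) :=
  (o (base x),
    if (f x < g x)%O then (s (ru x), w (n - ru x) x)
    else if (g x < f x)%O then ((- s (n - rv x)%N)%R, w (rv x) x)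
    else (0%R, w 0 x)).

Let eq_fg x y : o x = o y -> f x = f y /\ g x = g y.
Proof.
by move=> E; split; apply/eqP; rewrite ?(same_order_eq fo) ?(same_order_eq go) E.
Qed.

Lemma base_class x :
  (f (base x) < g (base x))%O = (f x < g x)%O /\
  (g (base x) < f (base x))%O = (g x < f x)%O.
Proof.
rewrite /base; case: (ltgtP (f x) (g x)) => [lt|gt|E]; last by rewrite E ltxx.
- have lt' := up_iter wO fo go n lt; split; first exact: lt'.
  by apply/negbTE; rewrite -leNgt; apply: ltW; apply: lt'.
- have gt' := up_iter wO go fo n gt; split; last exact: gt'.
  by apply/negbTE; rewrite -leNgt; apply: ltW; apply: gt'.
Qed.

Lemma base_le x : (o (base x) <= o x)%O.
Proof.
rewrite /base; case: ifP => _; first exact: (iter_step_le _ _ _ _ x (leq0n n)).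
by case: ifP => // _; apply: (iter_step_le _ _ _ _ x (leq0n n)).
Qed.

Lemma same_base_class x y : o (base x) = o (base y) ->
  (f x < g x)%O = (f y < g y)%O /\ (g x < f x)%O = (g y < f y)%O.
Proof.
move=> /eq_fg[Ef Eg]; have [<- <-] := base_class x; have [<- <-] := base_class y.
by rewrite Ef Eg.
Qed.

(** Otherwise [base x] lies strictly above [base y] and not above [y], so by [up_between] [x] moves
    in the direction of [y], where iterates are monotone. *)
Lemma base_mono x y : (o x <= o y)%O -> (o (base x) <= o (base y))%O.
Proof.
move=> xy; rewrite leNgt; apply/negP => lt.
have le := le_trans (base_le x) xy; have [cx cx'] := base_class x.
move: (lt) le; rewrite {1}/base; case: ifP => [uy|nuy].
  move=> lt1 /(up_between fo go uy lt1); rewrite cx => ux.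
  by move: lt; rewrite /base ux uy ltNge (iter_step_mono wO fo go).
case: ifP => [vy|nvy]; last by move=> /lt_le_trans/[apply]; rewrite ltxx.
move=> lt1 /(up_between go fo vy lt1); rewrite cx' => vx.
move: lt; rewrite /base vx vy nuy; have -> : (f x < g x)%O = false by apply/negbTE; rewrite -leNgt ltW.
by rewrite ltNge (iter_step_mono wO go fo).
Qed.

(** Each failing inequality links [x] and [y] in the sense of [up_linked], forcing [base y] below or
    at [base x]. Hence the base can be the leading component of [layered]. *)
Lemma base_lt x y : (o (base x) < o (base y))%O ->
  [/\ (o x < o y)%O, (f x < g y)%O & (g x < f y)%O].
Proof.
move=> lt; have xy : (o x < o y)%O.
  by rewrite ltNge; apply/negP => /base_mono; rewrite leNgt lt.
split=> //; rewrite ltNge; apply/negP => le.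
- have [vx vy le'] := up_linked go fo vstab xy le.
  move: lt; rewrite /base vx vy !(@ltNge _ _ (f _)) ltW //=.
  by rewrite (ltW vy) /= ltNge le'.
- have [ux uy le'] := up_linked fo go ustab xy le.
  by move: lt; rewrite /base ux uy ltNge le'.
Qed.

Let gt_nlt (x y : O) : (x < y)%O -> (y < x)%O = false.
Proof. by move=> /ltW; rewrite leNgt => /negbTE. Qed.

(** Over one base, ranks grow with the points by [rank_mono], and ties of rank are decided by a
    member of the walk [w]. Downwards, the sign and the reversed index cancel. *)
Lemma layered_pattern s : inc n.+1 s -> same_order (layered s) o.
Proof.
move=> sI x y; rewrite /layered.
case: (ltgtP (o (base x)) (o (base y))) => [lt|gt|E].
- have [lt' _ _] := base_lt lt.
  by rewrite lt' (lex3_fst _ _ lt).1.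
- have [lt' _ _] := base_lt gt.
  by rewrite (gt_nlt lt') (lex3_fst _ _ gt).2.
have [Eu Ev] := same_base_class E; rewrite -Eu -Ev.
have cmp r r' : (r < n.+1)%N -> (r' < n.+1)%N -> (s r < s r')%O = (r < r')%N.
  exact: inc_lt.
have cmpe r r' : (r < n.+1)%N -> (r' < n.+1)%N -> (s r == s r') = (r == r').
  by move=> rn rn'; rewrite eq_le !leNgt !cmp // -!leqNgt -eqn_leq eq_sym.
case: ifP => [ux|nux]; last case: ifP => [vx|nvx]; rewrite lex3_lt E ltxx eqxx /=.
- have uy : (f y < g y)%O by rewrite -Eu.
  have Eb : o (iter n u x) = o (iter n u y) by move: E; rewrite /base ux uy.
  have rm : forall z, (ru z < n.+1)%N by move=> z; rewrite ltnS; apply: rank_max.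
  rewrite cmp // cmpe //.
  case: (ltngtP (ru x) (ru y)) => [lt|gt|->] /=; last exact: w_o (leq_subr _ _) x y.
    apply/esym; rewrite ltNge; apply/negP => le.
    by have := rank_mono fo go uy ux (esym Eb) le; rewrite -/ru leqNgt lt.
  apply/esym/negbTE; rewrite -leNgt leNgt; apply/negP => /ltW le.
  by have := rank_mono fo go ux uy Eb le; rewrite -/ru leqNgt gt.
- have vy : (g y < f y)%O by rewrite -Ev.
  have Eb : o (iter n v x) = o (iter n v y).
    by move: E; rewrite /base nux -Eu nux vx vy.
  have rm : forall z, (n - rv z < n.+1)%N by move=> z; lia.
  have rm' : forall z, (rv z <= n)%N by move=> z; apply: rank_max.
  have -> : (- s (n - rv x)%N < - s (n - rv y)%N)%O%R = (rv x < rv y)%N.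
    have := cmp _ _ (rm y) (rm x); have := rm' x; have := rm' y; lia.
  have -> : (- s (n - rv x)%N == - s (n - rv y)%N)%R = (rv x == rv y)%N.
    have := cmpe _ _ (rm x) (rm y); have := rm' x; have := rm' y; lia.
  case: (ltngtP (rv x) (rv y)) => [lt|gt|->] /=; last exact: w_o (rm' y) x y.
    apply/esym; rewrite ltNge; apply/negP => le.
    by have := rank_mono go fo vy vx (esym Eb) le; rewrite -/rv leqNgt lt.
  apply/esym/negbTE; rewrite -leNgt leNgt; apply/negP => /ltW le.
  by have := rank_mono go fo vx vy Eb le; rewrite -/rv leqNgt gt.
- by rewrite w_o.
Qed.

Lemma layered_same_pattern s t s' t' : same_pattern n.+1 s t s' t' ->
  forall x y, (layered s x < layered t y)%O = (layered s' x < layered t' y)%O /\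
    (layered t y < layered s x)%O = (layered t' y < layered s' x)%O.
Proof.
move=> pat x y; rewrite /layered.
case: (ltgtP (o (base x)) (o (base y))) => [lt|gt|E].
- by rewrite !(lex3_fst _ _ lt).1 !(lex3_fst _ _ lt).2.
- by rewrite !(lex3_fst _ _ gt).1 !(lex3_fst _ _ gt).2.
have [Eu Ev] := same_base_class E; rewrite -Eu -Ev.
case: ifP => [ux|nux]; last case: ifP => [vx|nvx]; rewrite !lex3_lt E ltxx eqxx //=.
- have [p1 p2] := pat (ru x) (ru y) (rank_max _ _ _ _ _ _) (rank_max _ _ _ _ _ _).
  by rewrite !eq_le !leNgt p1 p2.
- have [p1 p2] := pat (n - rv x)%N (n - rv y)%N ltac:(lia) ltac:(lia).
  by split; congr (_ || (_ && _)); lia.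
Qed.

(** Upwards, [s (ru x)] meets [s (ru y).+1], so a tie is exactly the case left open by [rank_gt] and
    [rank_ngt]. There the last components are consecutive members of [w], which compare like [f] and
    [g]; downwards the roles of [f] and [g] are exchanged. *)
Lemma layered_shift s : inc n.+2 s -> forall x y,
  (layered s x < layered (s \o S) y)%O = (f x < g y)%O /\
  (layered (s \o S) y < layered s x)%O = (g y < f x)%O.
Proof.
move=> sI x y; rewrite /layered.
case: (ltgtP (o (base x)) (o (base y))) => [lt|gt|E].
- have [_ lt' _] := base_lt lt.
  by rewrite lt' (gt_nlt lt') (lex3_fst _ _ lt).1 (lex3_fst _ _ lt).2.
- have [_ _ lt'] := base_lt gt.
  by rewrite lt' (gt_nlt lt') (lex3_fst _ _ gt).1 (lex3_fst _ _ gt).2.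
have [Eu Ev] := same_base_class E; rewrite -Eu -Ev.
have cmp r r' : (r < n.+2)%N -> (r' < n.+2)%N -> (s r < s r')%O = (r < r')%N.
  exact: inc_lt.
case: ifP => [ux|nux]; last case: ifP => [vx|nvx]; rewrite !lex3_lt E ltxx eqxx /=.
- have uy : (f y < g y)%O by rewrite -Eu.
  have Eb : o (iter n u x) = o (iter n u y) by move: E; rewrite /base ux uy.
  have rm z : (ru z <= n)%N by apply: rank_max.
  have rx := rm x; have ry := rm y.
  have c1 := cmp (ru x) (ru y).+1 ltac:(lia) ltac:(lia).
  have c2 := cmp (ru y).+1 (ru x) ltac:(lia) ltac:(lia).
  rewrite !(eq_le (s _)) !leNgt c1 c2.
  case: (ltngtP (ru x) (ru y).+1) => [lt|gt|r] /=.
  + have lt' := rank_ngt fo go ustab ux uy Eb lt.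
    by rewrite lt' (gt_nlt lt').
  + have lt' := rank_gt fo go ustab ux uy Eb gt.
    by rewrite lt' (gt_nlt lt').
  + have -> : (n - ru y)%N = (n - ru x).+1 by lia.
    by apply: w_fg; lia.
- have vy : (g y < f y)%O by rewrite -Ev.
  have Eb : o (iter n v x) = o (iter n v y).
    by move: E; rewrite /base nux -Eu nux vx vy.
  have rm z : (rv z <= n)%N by apply: rank_max.
  have rx := rm x; have ry := rm y.
  have c1 := cmp (n - rv x)%N (n - rv y).+1 ltac:(lia) ltac:(lia).
  have c2 := cmp (n - rv y).+1 (n - rv x)%N ltac:(lia) ltac:(lia).
  have c3 : (- s (n - rv x)%N < - s (n - rv y).+1)%O%R = ((rv x).+1 < rv y)%N by lia.
  have c4 : (- s (n - rv y).+1 < - s (n - rv x)%N)%O%R = (rv y < (rv x).+1)%N by lia.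
  rewrite !(eq_le (- s _)%R) !leNgt c3 c4.
  case: (ltngtP (rv x).+1 (rv y)) => [lt|gt|r] /=.
  + have lt' := rank_gt go fo vstab vy vx (esym Eb) lt.
    by rewrite lt' (gt_nlt lt').
  + have lt' := rank_ngt go fo vstab vy vx (esym Eb) gt.
    by rewrite lt' (gt_nlt lt').
  + by rewrite -r; apply: w_fg; lia.
- have oE : o x = o y by move: E; rewrite /base -Eu -Ev nux nvx.
  have [fE gE] := eq_fg oE.
  have Efg : f x = g x by apply/eqP; rewrite eq_le !leNgt nux nvx.
  rewrite -gE Efg !ltxx.
  by split; rewrite w_o // oE ltxx.
Qed.

End Layers.

Lemma same_order_join (X : Type) d1 (O1 : porderType d1) d2 (O2 : porderType d2)
    (f g : X -> O1) (f' g' : X -> O2) :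
  same_order f f' -> same_order g g' ->
  (forall x y, (f x < g y)%O = (f' x < g' y)%O /\ (g y < f x)%O = (g' y < f' x)%O) ->
  same_order (join_fun f g) (join_fun f' g').
Proof.
by move=> ff' gg' fg [x|x] [y|y] //=; [exact: (fg x y).1|exact: (fg y x).2].
Qed.

Lemma same_order_sym (Y : Type) d1 (O1 : porderType d1) d2 (O2 : porderType d2)
    (h1 : Y -> O1) (h2 : Y -> O2) : same_order h1 h2 -> same_order h2 h1.
Proof. by move=> h y z; rewrite h. Qed.

Lemma same_order_trans (Y : Type) d1 (O1 : porderType d1) d2 (O2 : porderType d2)
    d3 (O3 : porderType d3) (h1 : Y -> O1) (h2 : Y -> O2) (h3 : Y -> O3) :
  same_order h1 h2 -> same_order h2 h3 -> same_order h1 h3.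
Proof. by move=> h12 h23 y z; rewrite h12. Qed.

Section Dichotomy.
Variables (X : Type) (d : Order.disp_t) (O : orderType d).
Hypothesis wO : is_ordinal O.

(* If iterating [step] takes unboundedly long to stabilise, the graph of the
   order type of [(f, g)] has few colours; otherwise it contains copies of a
   shift graph. *)
Lemma dichotomy (f g : X -> O) : same_order f g ->
  (exists c : (X -> O) -> set (nat * nat * nat), forall f' g',
     same_order (join_fun f' g') (join_fun f g) -> c f' <> c g') \/
  exists (n : nat) (F : (nat -> int) -> X -> O *l (int *l O)),
    [/\ forall s, inc n s -> same_order (F s) f,
        forall s t s' t', inc n s -> inc n t -> inc n s' -> inc n t' ->
          same_pattern n s t s' t' ->
          same_order (join_fun (F s) (F t)) (join_fun (F s') (F t')) &
        forall s, inc n.+1 s ->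
          same_order (join_fun (F s) (F (s \o S))) (join_fun f g)].
Proof.
move=> fg; pose D (f' g' : X -> O) := same_order (join_fun f' g') (join_fun f g).
have ff : same_order f f by [].
have gf : same_order g f by move=> x y; rewrite fg.
have Dl f' g' x y : D f' g' -> (f' x < f' y)%O = (f x < f y)%O.
  by move=> /(_ (inl x) (inl y)).
have Dr f' g' x y : D f' g' -> (g' x < g' y)%O = (f x < f y)%O.
  by move=> /(_ (inr x) (inr y)) /= ->; rewrite gf.
have Dlr f' g' x y : D f' g' -> (f' x < g' y)%O = (f x < g y)%O.
  by move=> /(_ (inl x) (inr y)).
have Drl f' g' x y : D f' g' -> (g' x < f' y)%O = (g x < f y)%O.
  by move=> /(_ (inr x) (inl y)).
case: (walk_or_colouring D) => [|walk]; first by left.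
case: (pselect (forall n, exists x,
    f (iter n (step wO f f g) x) <> f (iter n.+1 (step wO f f g) x))).
  move=> /(long_blocks ff gf)[y yP]; left.
  apply: (@drift_colouring _ _ _ D (fun h n k => h (y n k))) => f' g' n k Dfg kn;
    have [y1 y2 y3] := yP n.
  - by rewrite (Dl _ _ _ _ Dfg) (Dr _ _ _ _ Dfg) y1.
  - by rewrite leNgt (Drl _ _ _ _ Dfg) -leNgt y2.
  - by rewrite (Drl _ _ _ _ Dfg) y3.
move=> /existsNP[nu /forallNP nuP].
case: (pselect (forall n, exists x,
    f (iter n (step wO f g f) x) <> f (iter n.+1 (step wO f g f) x))).
  move=> /(long_blocks gf ff)[y yP]; left.
  have [|||c cP] := @drift_colouring _ _ _ (fun f' g' => D g' f') (fun h n k => h (y n k)).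
  - move=> f' g' n k Dfg kn; have [y1 y2 y3] := yP n.
    by rewrite (Dl _ _ _ _ Dfg) (Dr _ _ _ _ Dfg) y1.
  - move=> f' g' n k Dfg kn; have [y1 y2 y3] := yP n.
    by rewrite leNgt (Dlr _ _ _ _ Dfg) -leNgt y2.
  - move=> f' g' n k Dfg kn; have [y1 y2 y3] := yP n.
    by rewrite (Dlr _ _ _ _ Dfg) y3.
  - by exists c => f' g' /cP/nesym.
move=> /existsNP[nv /forallNP nvP]; right.
pose n := maxn nu nv.
have stab h k m : same_order h.1 f -> same_order h.2 f -> (m <= k)%N ->
    (forall x, ~ f (iter m (step wO f h.1 h.2) x) <> f (iter m.+1 (step wO f h.1 h.2) x)) ->
    forall x, f (iter k (step wO f h.1 h.2) x) = f (iter k.+1 (step wO f h.1 h.2) x).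
  move=> h1 h2 mk H x; rewrite -(subnK mk) -addnS !iterD.
  by apply: (iter_step_eq wO h1 h2); apply: contrapT.
have ustab := stab (f, g) _ _ ff gf (leq_maxl nu nv) nuP.
have vstab := stab (g, f) _ _ gf ff (leq_maxr nu nv) nvP.
(* With [n+1] edges each of [w 0] to [w n] starts an edge, hence has the order type of [f]. *)
have [w wD] := walk n.+1.
have w_f k : (k <= n)%N -> same_order (w k) f by move=> kn x y; apply: Dl (wD _ kn).
have w_fg k x y : (k < n)%N -> (w k x < w k.+1 y)%O = (f x < g y)%O /\
    (w k.+1 y < w k x)%O = (g y < f x)%O.
  by move=> kn; have Dk := wD k (leqW kn); rewrite (Dlr _ _ _ _ Dk) (Drl _ _ _ _ Dk).
have lp := layered_pattern ff gf ustab vstab w_f.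
exists n.+1, (layered wO f f g n w); split=> [||s sI].
- exact: lp.
- move=> s t s' t' sI tI sI' tI' pat; apply: same_order_join.
  + exact: same_order_trans (lp _ sI) (same_order_sym (lp _ sI')).
  + exact: same_order_trans (lp _ tI) (same_order_sym (lp _ tI')).
  + by move=> x y; have := layered_same_pattern wO ff gf w pat x y.
- apply: same_order_join.
  + exact: lp (inc_le (leqnSn _) sI).
  + apply: same_order_trans (same_order_sym gf); apply: lp; exact: inc_shift.
  + by move=> x y; have := layered_shift ff gf ustab vstab w_f w_fg sI x y.
Qed.

End Dichotomy.

(** * Indiscernibility *)

Section Rename.
Variable L : language.

Fixpoint trename n m (r : 'I_n -> 'I_m) (t : term L n) : term L m :=
  match t with
  | Var i => Var L (r i)
  | App f ts => App (fun i => trename r (ts i))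
  end.

Definition rcons_ren n m (i0 : 'I_m) (r : 'I_n -> 'I_m) : 'I_n.+1 -> 'I_m :=
  fun i => if unlift ord0 i is Some j then r j else i0.

Fixpoint frename n (phi : formula L n) : forall m, ('I_n -> 'I_m) -> formula L m :=
  match phi with
  | Falsum _ => fun m _ => Falsum L m
  | Equal _ t u => fun m r => Equal (trename r t) (trename r u)
  | Rel _ R ts => fun m r => Rel (fun i => trename r (ts i))
  | Imp _ phi psi => fun m r => Imp (frename phi r) (frename psi r)
  | All _ phi => fun m r => All (frename phi (rcons_ren ord0 (lift ord0 \o r)))
  end.

Variable M : structure L.

Lemma vcons0 n (x : M) (v : 'I_n -> M) : vcons x v ord0 = x.
Proof. by rewrite /vcons unlift_none. Qed.

Lemma vconsS n (x : M) (v : 'I_n -> M) j : vcons x v (lift ord0 j) = v j.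
Proof. by rewrite /vcons liftK. Qed.

Lemma vcons_ren n m (v : 'I_m -> M) i0 (r : 'I_n -> 'I_m) :
  v \o rcons_ren i0 r = vcons (v i0) (v \o r).
Proof. by apply/funext => i; rewrite /rcons_ren /vcons /=; case: unlift. Qed.

Lemma eval_rename n m (r : 'I_n -> 'I_m) (v : 'I_m -> M) (t : term L n) :
  eval v (trename r t) = eval (v \o r) t.
Proof.
by elim: t => //= f ts IH; congr func_interp; apply/funext.
Qed.

Lemma sat_rename n (phi : formula L n) m (r : 'I_n -> 'I_m) (v : 'I_m -> M) :
  sat (frename phi r) v = sat phi (v \o r).
Proof.
elim: phi m r v => {n} [//|n t u|n R ts|n phi IH1 psi IH2|n phi IH] m r v /=.
- by rewrite !eval_rename.
- by congr rel_interp; apply/funext => i; apply: eval_rename.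
- by rewrite IH1 IH2.
- apply: eq_forall => x; rewrite IH vcons_ren vcons0; congr (sat _ (vcons _ _)).
  by apply/funext => i; rewrite /= vconsS.
Qed.

Lemma tp_sat_size (x0 : M) (s t : seq M) : tp s = tp t ->
  forall phi : formula L (size s), sat phi (tnth (in_tuple s)) ->
  size s = size t /\ sat phi (fun i => nth x0 t i).
Proof.
move=> st phi; have tnthE (u : seq M) : tnth (in_tuple u) = fun i => nth x0 u i.
  by apply/funext => i; rewrite (tnth_nth x0).
move=> phiT; have : tp s (existT _ (size s) phi) by exists phi.
rewrite st => -[psi E]; rewrite tnthE; split; first exact: (congr1 (@projT1 _ _) E).
(* [S] evaluates a packed formula at [t] for any number of variables, so the equality of dependent
   pairs can be rewritten without inverting it. *)
pose S (p : {n : nat & formula L n}) := sat (projT2 p) (fun i => nth x0 t i).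
have : S (existT _ _ psi) by [].
by rewrite -E.
Qed.

Lemma tp_size (s t : seq M) : tp s = tp t -> size s = size t.
Proof.
case: s t => [|x s] [|y t] // E.
- by have [] := tp_sat_size y E (phi := Imp (Falsum L _) (Falsum L _)) id.
- by have [] := tp_sat_size x E (phi := Imp (Falsum L _) (Falsum L _)) id.
- by have [] := tp_sat_size x E (phi := Imp (Falsum L _) (Falsum L _)) id.
Qed.

Lemma tp_sat (x0 : M) (s t : seq M) m (phi : formula L m) (c : 'I_m -> nat) :
  tp s = tp t -> (forall z, c z < size s)%N ->
  sat phi (fun z => nth x0 s (c z)) -> sat phi (fun z => nth x0 t (c z)).
Proof.
move=> st cs phis; pose r z := Ordinal (cs z).
have [|_] := tp_sat_size x0 st (phi := frename phi r); last by rewrite sat_rename.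
rewrite sat_rename; congr sat: phis.
by apply/funext => z; rewrite /= (tnth_nth x0).
Qed.

End Rename.

Lemma In_nth (T : Type) (x0 x : T) (s : seq T) :
  List.In x s -> exists2 p, (p < size s)%N & nth x0 s p = x.
Proof.
elim: s => //= y s IH [->|/IH[p ps <-]]; first by exists 0.
by exists p.+1.
Qed.

Lemma same_order_partial_iso (Y : Type) d (I : orderType d) (h h' : Y -> I) :
  same_order h h' -> exists (D : set I) (pi : I -> I),
    partial_iso D pi /\ forall y, D (h y) /\ pi (h y) = h' y.
Proof.
move=> hh'; have /choice[pi piP] z : exists b, forall y, h y = z -> h' y = b.
  case: (pselect (exists y, h y = z)) => [[y <-]|nz]; last first.
    by exists z => y E; case: nz; exists y.
  by exists (h' y) => y' E; apply/eqP; rewrite -(same_order_eq hh') E.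
have piE y : pi (h y) = h' y by rewrite (piP (h y)).
exists (range h), pi; split=> [_ _ [y _ <-] [z _ <-]|y]; first by rewrite !piE hh'.
by split=> //; exists y.
Qed.

Section Indiscernible.
Variables (L : language) (M : structure L) (U : Type).
Variables (dk : Order.disp_t) (kappa : orderType dk) (alpha : U -> kappa).
Variables (di : Order.disp_t) (I : orderType di).
Variable a : forall i : U, incr_fun (alpha i) I -> seq M.
Hypothesis a_ind : indiscernible a.
Variable x0 : M.

Let tuples (J : Type) (i : J -> U) := forall j, incr_fun (alpha (i j)) I.

Let entries (J : Type) (i : J -> U) (eta : tuples i) :
    {j & below (alpha (i j))} -> I :=
  fun y => sval (eta (tag y)) (tagged y).

Lemma indiscernible_fin (J : finType) (i : J -> U) (eta rho : tuples i) :
  same_order (entries eta) (entries rho) ->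
  tp (flatten [seq a (eta (enum_val j)) | j <- enum 'I_#|J|]) =
  tp (flatten [seq a (rho (enum_val j)) | j <- enum 'I_#|J|]).
Proof.
move=> /same_order_partial_iso[D [pi [piD piP]]].
apply: (a_ind (i := fun j => i (enum_val j)) (eta := fun j => eta (enum_val j))
  (rho := fun j => rho (enum_val j)) piD) => j x.
exact: (piP (existT _ (enum_val j) x)).
Qed.

Lemma size_indiscernible i (eta rho : incr_fun (alpha i) I) :
  size (a eta) = size (a rho).
Proof.
have lt (e : incr_fun (alpha i) I) x y : (sval e x < sval e y)%O = (sval x < sval y)%O.
  case: (ltgtP (sval x) (sval y)) => [xy|yx|E]; first exact: (svalP e).
    by apply/negbTE; rewrite -leNgt; apply: ltW; apply: (svalP e).
  by rewrite (sval_inj E) ltxx.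
have := @indiscernible_fin unit (fun=> i) (fun=> eta) (fun=> rho).
move=> H; have /tp_size : tp (flatten [seq a eta | j <- enum 'I_#|{: unit}|]) =
    tp (flatten [seq a rho | j <- enum 'I_#|{: unit}|]).
  by apply: H => -[[] x] [[] y]; rewrite /entries /= !lt.
have sizeE (T : Type) (u : seq M) (r : seq T) :
    size (flatten [seq u | j <- r]) = (size r * size u)%N.
  by elim: r => //= j r IH; rewrite size_cat IH mulSn.
by rewrite !sizeE size_enum_ord card_unit !mul1n.
Qed.

Lemma sat_indiscernible (J : finType) (i : J -> U) (eta rho : tuples i)
    m (phi : formula L m) (c : 'I_m -> J) (p : 'I_m -> nat) :
  same_order (entries eta) (entries rho) ->
  (forall z, p z < size (a (eta (c z))))%N ->
  sat phi (fun z => nth x0 (a (eta (c z))) (p z)) ->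
  sat phi (fun z => nth x0 (a (rho (c z))) (p z)).
Proof.
move=> er pz.
pose fl (e : tuples i) := [seq a (e (enum_val j)) | j <- enum 'I_#|J|].
have shE (e : tuples i) : shape (fl e) = shape (fl eta).
  by rewrite /shape /fl -!map_comp; apply: eq_map => j /=; apply: size_indiscernible.
pose q z := flatten_index (shape (fl eta)) (enum_rank (c z)) (p z).
have sz (e : tuples i) z : nth 0 (shape (fl e)) (enum_rank (c z)) = size (a (e (c z))).
  rewrite /shape /fl -map_comp (nth_map (enum_rank (c z))) ?size_enum_ord //.
  by rewrite nth_ord_enum /= enum_rankK.
have pz' (e : tuples i) z : (p z < nth 0 (shape (fl e)) (enum_rank (c z)))%N.
  by rewrite sz (size_indiscernible (e (c z)) (eta (c z))).
have nthE (e : tuples i) z : nth x0 (flatten (fl e)) (q z) = nth x0 (a (e (c z))) (p z).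
  rewrite nth_flatten /q -(shE e) flatten_indexKl // flatten_indexKr //.
  rewrite (nth_map (enum_rank (c z))) ?size_enum_ord // nth_ord_enum.
  by rewrite enum_rankK.
have qlt z : (q z < size (flatten (fl eta)))%N.
  by rewrite size_flatten; apply: flatten_indexP.
have := tp_sat (x0 := x0) (phi := phi) (indiscernible_fin er) qlt.
have fE (e : tuples i) : (fun z => nth x0 (flatten (fl e)) (q z)) =
    fun z => nth x0 (a (e (c z))) (p z) by apply/funext.
by rewrite -!fE.
Qed.

End Indiscernible.

(** * Elements of the model denoted by functions into the index order *)

Section Denotation.
Variables (L : language) (M : structure L) (U : Type).
Variables (dk : Order.disp_t) (kappa : orderType dk) (alpha : U -> kappa).
Variables (di : Order.disp_t) (I : orderType di).
Variable a : forall i : U, incr_fun (alpha i) I -> seq M.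
Hypothesis a_ind : indiscernible a.
Variable x0 : M.
Variables (k : nat) (phi : formula L k.+1) (i : 'I_k -> U) (p : 'I_k -> nat).

(** The disjoint sum of the domains, on which a tuple of [k] increasing functions becomes a single
    function. *)
Definition index : Type := {j : 'I_k & below (alpha (i j))}.

Let tuples := forall j, incr_fun (alpha (i j)) I.
Let entries (eta : tuples) (y : index) : I := sval (eta (tag y)) (tagged y).
Let vals (eta : tuples) (z : 'I_k) : M := nth x0 (a (eta z)) (p z).

(* [y] is the element defined by [phi] from the [p z]-th entries of the tuples
   of the indiscernible sequence indexed by the components of [f]. *)
Definition denotes (f : index -> I) (y : M) : Prop :=
  exists eta : tuples, [/\ entries eta = f, forall z, (p z < size (a (eta z)))%N &
    forall y', sat phi (vcons y' (vals eta)) <-> y' = y].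

Let vals2 (eta eta' : tuples) (z : 'I_(k + k)) : M :=
  match fintype.split z with inl z => vals eta z | inr z => vals eta' z end.

Let sat2 (chi : formula L (k + k)) (eta eta' rho rho' : tuples) :
  same_order (join_fun (entries eta) (entries eta'))
    (join_fun (entries rho) (entries rho')) ->
  (forall z, p z < size (a (eta z)))%N ->
  sat chi (vals2 eta eta') -> sat chi (vals2 rho rho').
Proof.
move=> er pz.
pose i2 (j : 'I_k + 'I_k) := match j with inl j => i j | inr j => i j end.
pose p2 (j : 'I_k + 'I_k) := match j with inl j => p j | inr j => p j end.
pose two (e e' : tuples) (j : 'I_k + 'I_k) : incr_fun (alpha (i2 j)) I :=
  match j with inl j => e j | inr j => e' j end.
have pz' z : (p2 (fintype.split z) < size (a (two eta eta' (fintype.split z))))%N.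
  by case: fintype.split => z' //=; rewrite (size_indiscernible a_ind (eta' z') (eta z')).
have := sat_indiscernible a_ind (x0 := x0) (phi := chi)
  (eta := two eta eta') (rho := two rho rho') (c := @fintype.split k k)
  (p := p2 \o @fintype.split k k) _ pz'.
have E (e e' : tuples) : vals2 e e' =
    fun z => nth x0 (a (two e e' (fintype.split z))) ((p2 \o @fintype.split k k) z).
  by apply/funext => z; rewrite /vals2 /=; case: fintype.split.
rewrite !E; apply => -[[j|j] x] [[j'|j'] x'].
- exact: (er (inl (existT _ j x)) (inl (existT _ j' x'))).
- exact: (er (inl (existT _ j x)) (inr (existT _ j' x'))).
- exact: (er (inr (existT _ j x)) (inl (existT _ j' x'))).
- exact: (er (inr (existT _ j x)) (inr (existT _ j' x'))).
Qed.

Let ren1 : 'I_k.+1 -> 'I_(k + k).+2 :=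
  rcons_ren (lift ord0 ord0) (lift ord0 \o (lift ord0 \o @lshift k k)).
Let ren2 : 'I_k.+1 -> 'I_(k + k).+2 :=
  rcons_ren ord0 (lift ord0 \o (lift ord0 \o @rshift k k)).
Let ren3 : 'I_2 -> 'I_(k + k).+2 := rcons_ren (lift ord0 ord0) (fun=> ord0).

(** Turns a statement about two denoted elements into one about the entries defining them, to which
    indiscernibility applies. Under the quantifiers [ord0] is the second element and
    [lift ord0 ord0] the first. *)
Let both (psi : formula L 2) : formula L (k + k) :=
  All (All (Imp (frename phi ren1) (Imp (frename phi ren2) (frename psi ren3)))).

Let sat_both psi eta eta' : sat (both psi) (vals2 eta eta') <->
  forall y y', sat phi (vcons y (vals eta)) -> sat phi (vcons y' (vals eta')) ->
    sat psi (vcons y (fun=> y')).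
Proof.
set v := vals2 eta eta'.
have v1 y y' : vcons y' (vcons y v) \o ren1 = vcons y (vals eta).
  rewrite vcons_ren vconsS vcons0; congr vcons; apply/funext => z.
  by rewrite /= !vconsS /v /vals2 (unsplitK (inl z)).
have v2 y y' : vcons y' (vcons y v) \o ren2 = vcons y' (vals eta').
  rewrite vcons_ren vcons0; congr vcons; apply/funext => z.
  by rewrite /= !vconsS /v /vals2 (unsplitK (inr z)).
have v3 y y' : vcons y' (vcons y v) \o ren3 = vcons y (fun=> y').
  rewrite vcons_ren vconsS vcons0; congr vcons; apply/funext => z.
  by rewrite /= vcons0.
have E y y' : (sat phi (vcons y (vals eta)) -> sat phi (vcons y' (vals eta')) ->
     sat psi (vcons y (fun=> y'))) =
   (sat (frename phi ren1) (vcons y' (vcons y v)) ->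
    sat (frename phi ren2) (vcons y' (vcons y v)) ->
    sat (frename psi ren3) (vcons y' (vcons y v))).
  by rewrite !sat_rename v1 v2 v3.
by split=> H y y'; have := H y y'; [rewrite E|rewrite E].
Qed.

Lemma denotes_transfer (psi : formula L 2) f g f' g' y z y' z' :
  same_order (join_fun f g) (join_fun f' g') ->
  denotes f y -> denotes g z -> denotes f' y' -> denotes g' z' ->
  sat psi (vcons y (fun=> z)) -> sat psi (vcons y' (fun=> z')).
Proof.
move=> o [e [fE pe eP]] [e' [gE pe' eP']] [r [fE' pr rP]] [r' [gE' pr' rP']].
rewrite -fE -gE -fE' -gE' in o => psiyz.
have : sat (both psi) (vals2 r r').
  by apply: (sat2 o pe); apply/sat_both => ? ? /eP -> /eP' ->.
by move=> /sat_both; apply; [apply/rP|apply/rP'].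
Qed.

Lemma denotes_eq f g f' g' y z y' z' :
  same_order (join_fun f g) (join_fun f' g') ->
  denotes f y -> denotes g z -> denotes f' y' -> denotes g' z' ->
  y = z -> y' = z'.
Proof.
move=> o fy gz fy' gz' E.
have := denotes_transfer (psi := Equal (Var L ord0) (Var L (lift ord0 ord0))) o fy gz fy' gz'.
by rewrite /= !vcons0 !vconsS; apply.
Qed.

Lemma denotes_edge (E : rel_symb L) f g f' g' y z y' z' :
  same_order (join_fun f g) (join_fun f' g') ->
  denotes f y -> denotes g z -> denotes f' y' -> denotes g' z' ->
  edge E y z -> edge E y' z'.
Proof.
move=> o fy gz fy' gz'.
have := denotes_transfer (psi := Rel (fun j : 'I_(rel_arity E) =>
  if val j == 0%N then Var L ord0 else Var L (lift ord0 ord0))) o fy gz fy' gz'.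
rewrite /= /edge; set u := fun _ => _; set v := fun _ => _; set w := fun _ => _.
set t := fun _ => _.
suff [-> ->] : u = w /\ v = t by [].
by split; apply/funext => j; rewrite /u /v /w /t; case: ifP => _ /=; rewrite ?vcons0 ?vconsS.
Qed.

(** Existence and uniqueness of the defined element are first-order properties of the entries. Both
    are transferred by pairing a tuple with itself. *)
Lemma denotes_exists f f' y : same_order f' f -> denotes f y ->
  exists y', denotes f' y'.
Proof.
move=> o [e [fE pe eP]].
have rho_inc j (x x' : below (alpha (i j))) : (sval x < sval x')%O ->
    (f' (existT _ j x) < f' (existT _ j x'))%O.
  by rewrite o -fE; apply: (svalP (e j)).
pose r : tuples := fun j => exist _ (fun x => f' (existT _ j x)) (rho_inc j).
have rE : entries r = f' by apply/funext => -[j x].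
have pr z : (p z < size (a (r z)))%N by rewrite (size_indiscernible a_ind (r z) (e z)).
have o2 : same_order (join_fun (entries e) (entries e)) (join_fun (entries r) (entries r)).
  by rewrite rE fE => -[x|x] [x'|x'] /=; rewrite o.
pose ren : 'I_k.+1 -> 'I_(k + k).+1 := rcons_ren ord0 (lift ord0 \o @lshift k k).
have satE (e' : tuples) y' : sat (frename phi ren) (vcons y' (vals2 e' e')) =
    sat phi (vcons y' (vals e')).
  rewrite sat_rename vcons_ren vcons0; congr (sat _ (vcons _ _)).
  by apply/funext => z; rewrite /= vconsS /vals2 (unsplitK (inl z)).
have [y' y'P] : exists y', sat phi (vcons y' (vals r)).
  apply: contrapT => /forallNP ny.
  have := sat2 (chi := Imp (All (Imp (frename phi ren) (Falsum L _))) (Falsum L _)) o2 pe.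
  rewrite /=; apply=> [H|y']; last by rewrite satE; apply: ny.
  by apply: (H y); rewrite satE; apply/eP.
exists y', r; split=> // z; split=> [zP|->//].
pose psi : formula L 2 := Equal (Var L ord0) (Var L (lift ord0 ord0)).
have /sat_both/(_ z y' zP y'P) : sat (both psi) (vals2 r r).
  apply: (sat2 o2 pe); apply/sat_both => ? ? /eP -> /eP ->.
  by rewrite /= vcons0 vconsS.
by rewrite /= vcons0 vconsS.
Qed.

End Denotation.

Lemma dcl_denotes (L : language) (M : structure L) (U : Type)
    (dk : Order.disp_t) (kappa : orderType dk) (alpha : U -> kappa)
    (di : Order.disp_t) (I : orderType di)
    (a : forall i : U, incr_fun (alpha i) I -> seq M) (x0 y : M) :
  dcl (Rg a) y ->
  exists k (phi : formula L k.+1) (i : 'I_k -> U) (p : 'I_k -> nat) f,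
    denotes a x0 phi p (i := i) f y.
Proof.
move=> [s sR [phi phiP]].
have ex (z : 'I_(size s)) : exists q : {i : U & incr_fun (alpha i) I} * nat,
    (q.2 < size (a _ (tagged q.1)))%N /\ nth x0 (a _ (tagged q.1)) q.2 = tnth (in_tuple s) z.
  have [|i [eta /(In_nth x0)[p ps E]]] := sR (tnth (in_tuple s) z).
    rewrite (tnth_nth x0) /=; case: z => z /=.
    by elim: (s) z => //= b r IH [|z] zs; [left|right; apply: IH].
  by exists (existT _ i eta, p).
have [q qP] := choice ex.
exists (size s), phi, (fun z => tag (q z).1), (fun z => (q z).2).
eexists; exists (fun z => tagged (q z).1); split=> [//|z|y'].
  by have [] := qP z.
have <- : tnth (in_tuple s) = fun z => nth x0 (a _ (tagged (q z).1)) (q z).2.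
  by apply/funext => z; have [_] := qP z.
exact: phiP.
Qed.

(** * Realising finitely many functions inside the index order *)

Lemma nat_card_leq_fin (F : finType) : ~ card_leq nat F.
Proof.
move=> /card_leqP[f fi]; have gi : injective (fun i : 'I_#|F|.+1 => f i).
  by move=> i j /fi /val_inj.
by have := leq_card _ gi; rewrite card_ord ltnn.
Qed.

(** Each [h j] is well-founded because it has the order type of [f]. The least of the finitely many
    layerwise minima of inaccessible points would have only accessible points below it. *)
Lemma wf_family (X : Type) dO (O : orderType dO) dt (theta : orderType dt)
    (J : finType) (h : J -> X -> O) (f : X -> theta) :
  is_ordinal theta -> (forall j, same_order (h j) f) ->
  well_founded (fun y z : J * X => (h y.1 y.2 < h z.1 z.2)%O).
Proof.
move=> wt hf y0; apply: contrapT => ny0.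
pose lt (y z : J * X) := (h y.1 y.2 < h z.1 z.2)%O.
have /choice[m mP] j : exists x, (exists x', ~ Acc lt (j, x')) ->
    ~ Acc lt (j, x) /\ forall x', ~ Acc lt (j, x') -> (f x <= f x')%O.
  case: (pselect (exists x', ~ Acc lt (j, x'))) => [[x' nx']|]; last by exists y0.2.
  have [_ [x nx <-] xmin] : exists2 b, (exists2 x, ~ Acc lt (j, x) & f x = b) &
      forall b', (exists2 x, ~ Acc lt (j, x) & f x = b') -> (b <= b')%O.
    by apply: wo_min => //; exists (f x'), x'.
  by exists x => _; split=> // z nz; apply: xmin; exists z.
pose P j := `[< exists x', ~ Acc lt (j, x') >].
have P0 : P y0.1 by apply/asboolP; exists y0.2; case: y0 ny0.
case: (@arg_minP _ _ _ y0.1 P (fun j => h j (m j)) P0) => j /asboolP Pj jmin.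
have [nj _] := mP j Pj; apply: nj; constructor=> -[j' x'] ltj; apply: contrapT => nx'.
have Pj' : exists x', ~ Acc lt (j', x') by exists x'.
have [_ /(_ _ nx')] := mP j' Pj'; rewrite -(same_order_le (hf j')) => le.
have := jmin j' (introT (asboolP _) Pj'); rewrite leNgt => /negP; apply.
exact: le_lt_trans le ltj.
Qed.

Section InfiniteCardinal.
Variables (dk : Order.disp_t) (kappa : orderType dk).
Hypothesis hkappa : is_infinite_cardinal kappa.

Lemma infinite_cardinal_nat : card_leq nat kappa.
Proof. by have [_ /infiniteP] := hkappa. Qed.

Lemma below_not_geq (b : kappa) : ~ card_leq kappa (below b).
Proof. by have [_ _ /(_ b) nb] := hkappa; move=> le; apply: nb; apply/card_le_setP. Qed.

Lemma card_leq_fin_nat (F : finType) : card_leq F nat.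
Proof.
apply/card_leqP; exists (fun x => nat_of_ord (enum_rank x)).
by move=> x y /val_inj /enum_rank_inj.
Qed.

Lemma fin_below_not_geq (F : finType) (b : kappa) : ~ card_leq kappa (F * below b).
Proof.
move=> le; case: (pselect (card_leq nat (below b))) => [inf|/finite_card_leq[m fin]].
  apply: (@below_not_geq b); apply: card_leq_trans le _.
  apply: card_leq_trans (card_leq_square inf).
  apply: card_leq_prod (card_leq_refl _).
  exact: card_leq_trans (card_leq_fin_nat F) inf.
apply: (@nat_card_leq_fin (F * 'I_m)%type).
apply: card_leq_trans infinite_cardinal_nat _; apply: card_leq_trans le _.
exact: card_leq_prod (card_leq_refl _) fin.
Qed.

Variables (U : Type) (alpha : U -> kappa) (k : nat) (i : 'I_k -> U).

Lemma index_card_leq : exists b : kappa, card_leq (index alpha i) ('I_k * below b).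
Proof.
have [/card_leqP[j _]] : card_leq nat kappa by exact: infinite_cardinal_nat.
(* The start value [j 0%N] provides a bound also for [k = 0]. *)
pose b := \big[Order.max/j 0%N]_z alpha (i z).
have bP z : (alpha (i z) <= b)%O by apply: le_bigmax.
exists b; apply/card_leqP.
exists (fun y : index alpha i => (tag y,
  exist (fun x => x < b)%O (sval (tagged y)) (lt_le_trans (svalP (tagged y)) (bP (tag y))))).
move=> [z x] [z' x'] /= [E]; subst z' => E; congr existT; apply: sval_inj.
exact: E.
Qed.

(** [kappa] does not embed in the joint domain of finitely many such functions, so [collapse] maps
    their values into [kappa], which embeds in [theta]. *)
Lemma realise dt (theta : orderType dt) dO (O : orderType dO) (J : finType)
    (h : J -> index alpha i -> O) (f : index alpha i -> theta) :
  is_ordinal theta -> ordinal_less kappa theta -> (forall j, same_order (h j) f) ->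
  exists h' : J -> index alpha i -> theta,
    forall j j', same_order (join_fun (h' j) (h' j')) (join_fun (h j) (h j')).
Proof.
move=> wt [_ [e [e_lt _]]] hf; have [wk _ _] := hkappa.
have nle : ~ card_leq kappa (J * index alpha i).
  have [b /(card_leq_prod (card_leq_refl J)) le] := index_card_leq.
  move=> /card_leq_trans/(_ le) le'.
  apply: (@fin_below_not_geq (J * 'I_k)%type b); apply: card_leq_trans le' _.
  apply/card_leqP; exists (fun y => ((y.1, y.2.1), y.2.2)).
  by move=> [j [z x]] [j' [z' x']] [-> -> ->].
have [r rP] := collapse (h := fun y : J * index alpha i => h y.1 y.2) wk nle (wf_family wt hf).
exists (fun j x => e (r (j, x))) => j j'.
by move=> [x|x] [x'|x'] /=; rewrite e_lt rP.
Qed.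

(** [Z] consists of the predecessors of [b] if these are infinite, and is [nat] otherwise; the
    summand [aleph1] makes [nat] small enough even for countable [kappa]. *)
Lemma index_bound (aleph1 P : Type) : is_succ_card nat aleph1 ->
  is_weak_power (kappa + aleph1) P ->
  exists Z : Type, [/\ card_leq nat Z, card_leq (index alpha i) Z & card_leq (set Z) P].
Proof.
move=> [[nat_a nna] _] [hP _]; have [b le] := index_card_leq.
have kl : card_leq kappa (kappa + aleph1) by apply/card_leqP; exists inl => x y [].
have al : card_leq aleph1 (kappa + aleph1) by apply/card_leqP; exists inr => x y [].
case: (pselect (card_leq nat (below b))) => [inf|/finite_card_leq[m fin]].
  exists (below b); split=> //.
    apply: card_leq_trans le _; apply: card_leq_trans (card_leq_square inf).
    apply: card_leq_prod (card_leq_refl _).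
    exact: card_leq_trans (card_leq_fin_nat _) inf.
  apply: hP; split.
    by apply: card_leq_trans kl; apply/card_leqP; exists sval; apply: sval_inj.
  by move=> /(card_leq_trans kl) /below_not_geq.
exists nat; split; first exact: card_leq_refl.
  apply: card_leq_trans le _.
  apply: card_leq_trans (card_leq_prod (card_leq_refl _) fin) _.
  exact: card_leq_fin_nat.
apply: hP; split; first exact: card_leq_trans nat_a al.
by move=> /(card_leq_trans al).
Qed.

End InfiniteCardinal.

(** * Shift graphs inside the model *)

Section Embedding.
Variables (L : language) (E : rel_symb L) (M : structure L).
Hypothesis E_graph : graph_rel (edge E (M := M)).
Variables (U : Type) (dk : Order.disp_t) (kappa : orderType dk) (alpha : U -> kappa).
Hypothesis hkappa : is_infinite_cardinal kappa.
Variables (dt : Order.disp_t) (theta : orderType dt).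
Hypotheses (wt : is_ordinal theta) (kt : ordinal_less kappa theta).
Variable a : forall i : U, incr_fun (alpha i) theta -> seq M.
Hypothesis a_ind : indiscernible a.
Variable x0 : M.
Variables (k : nat) (phi : formula L k.+1) (i : 'I_k -> U) (p : 'I_k -> nat).

Let X := index alpha i.
Let den := denotes a x0 phi p (i := i).

Variables (dO : Order.disp_t) (O : orderType dO).
Variables (f0 g0 : X -> theta) (v0 w0 : M).
Hypotheses (f0v : den f0 v0) (g0w : den g0 w0) (vw : edge E v0 w0).
Variables (n : nat) (F : (nat -> int) -> X -> O).
Hypothesis F_pattern : forall s, inc n s -> same_order (F s) f0.
Hypothesis F_inv : forall s t s' t', inc n s -> inc n t -> inc n s' -> inc n t' ->
  same_pattern n s t s' t' ->
  same_order (join_fun (F s) (F t)) (join_fun (F s') (F t')).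
Hypothesis F_shift : forall s, inc n.+1 s ->
  same_order (join_fun (F s) (F (s \o S))) (join_fun f0 g0).

(** Reads a relation of the model on integer tuples through some realisation of their order type in
    [theta]; by indiscernibility all realisations agree. *)
Let rel (r : M -> M -> Prop) (s t : nat -> int) : Prop := exists f g v w,
  [/\ same_order (join_fun f g) (join_fun (F s) (F t)), den f v, den g w & r v w].

Let R := rel eq.
Let A := rel (edge E (M := M)).

Let realise_tuples (J : finType) (s : J -> nat -> int) : (forall j, inc n (s j)) ->
  exists v : J -> M, forall j j', (R (s j) (s j') <-> v j = v j') /\
    (A (s j) (s j') <-> edge E (v j) (v j')).
Proof.
move=> sI.
have [h hP] := realise (h := fun j => F (s j)) hkappa wt kt (fun j => F_pattern (sI j)).
have /choice[v hv] j : exists v, den (h j) v.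
  apply: denotes_exists f0v => // x y.
  by rewrite -(F_pattern (sI j)) -(hP j j (inl x) (inl y)).
exists v => j j'; split; split.
- move=> [f [g [y [z [o fy gz]]]]].
  exact: denotes_eq (same_order_trans o (same_order_sym (hP j j'))) fy gz (hv j) (hv j').
- by exists (h j), (h j'), (v j), (v j').
- move=> [f [g [y [z [o fy gz]]]]].
  exact: denotes_edge (same_order_trans o (same_order_sym (hP j j'))) fy gz (hv j) (hv j').
- by exists (h j), (h j'), (v j), (v j').
Qed.

Lemma model_shift_system : shift_system n R A.
Proof.
(* Each axiom that is checked inside the model involves at most four tuples, which are realised
   simultaneously. *)
have four (s t s' t' : nat -> int) : inc n s -> inc n t -> inc n s' -> inc n t' ->
    exists v : bool * bool -> M, forall j j',
    let q j := if j.1 then if j.2 then s else t else if j.2 then s' else t' in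
    (R (q j) (q j') <-> v j = v j') /\ (A (q j) (q j') <-> edge E (v j) (v j')).
  move=> sI tI sI' tI'; apply: (@realise_tuples (bool * bool)%type
    (fun j => if j.1 then if j.2 then s else t else if j.2 then s' else t')).
  by move=> [[] []].
split.
- move=> s t s' t' sI tI sI' tI' pat [f [g [v [w [o fv gw E1]]]]].
  exists f, g, v, w; split=> //; apply: same_order_trans o _.
  exact: F_inv.
- move=> s sI; have [v vP] := four s s s s sI sI sI sI.
  exact/(vP (true, true) (true, true)).1.
- move=> s t sI tI; have [v vP] := four s t s t sI tI sI tI.
  by move=> /(vP (true, true) (true, false)).1 E1; apply/(vP (true, false) (true, true)).1.
- move=> s t u sI tI uI; have [v vP] := four s t u u sI tI uI uI.
  move=> /(vP (true, true) (true, false)).1 E1 /(vP (true, false) (false, true)).1 E2.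
  by apply/(vP (true, true) (false, true)).1; rewrite E1.
- move=> s t s' t' sI tI sI' tI'; have [v vP] := four s t s' t' sI tI sI' tI'.
  move=> /(vP (true, true) (false, true)).1 E1 /(vP (true, false) (false, false)).1 E2.
  move=> /(vP (true, true) (true, false)).2; rewrite E1 E2 => e.
  exact/(vP (false, true) (false, false)).2.
- move=> s sI; have [v vP] := four s s s s sI sI sI sI.
  by move=> /(vP (true, true) (true, true)).2; apply: E_graph.2.
- move=> s sI; exists f0, g0, v0, w0; split=> //.
  exact: same_order_sym (F_shift sI).
Qed.

Lemma model_contains_shift : exists m : nat, (1 <= m)%N /\
  contains_finite_subgraphs (edge E (M := M)) (@shift_edge m _ nat).
Proof.
have H := model_shift_system.
have [m m0 [G [GI GR GS]]] := shift_system_inj H; exists m; split=> //.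
move=> W D Wfin [Dsym _] DW.
pose sg (x : shift_vertex m nat) (j : nat) : nat := nth 0 (sval x) j.
have sgE x (j : 'I_m) : tnth (sval x) j = sg x j by rewrite (tnth_nth 0).
have sgI x : inc m (sg x).
  case: x => [s srt] j l jl lm; rewrite /sg /= ltEnat.
  by apply: (sorted_ltn_nth ltn_trans 0 srt); rewrite ?inE ?size_tuple //; apply: ltn_trans lm.
have [r Wr] : exists r : seq (shift_vertex m nat), W = [set` r] by apply/finite_seqP.
have [v vP] := realise_tuples (s := fun j : 'I_(size r) => G (sg (tnth (in_tuple r) j)))
  (fun j => GI _ (sgI _)).
have /choice[f fP] x : exists y, W x -> exists2 j, tnth (in_tuple r) j = x & y = v j.
  case: (pselect (W x)) => [Wx|nW]; last by exists x0.
  have : x \in in_tuple r by move: Wx; rewrite Wr.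
  by move=> /tnthP[j ->]; exists (v j) => _; exists j.
(* Prefixing [y] with the first entry of [x] gives a tuple of length [m+1] that starts with [x] and
   whose shift is [y]. *)
have shiftA x y : inc m.+1 (fun j => if j is j'.+1 then sg y j' else sg x 0) ->
    (forall j, (j.+1 < m)%N -> sg x j.+1 = sg y j) -> A (G (sg x)) (G (sg y)).
  set t := fun _ => _ => tI xy; have tI' := inc_le (leqnSn m) tI.
  apply: (ss_congr H (GI _ tI') (GI _ (sgI y)) (GI _ (sgI x)) (GI _ (sgI y)) _ _ (GS t tI)).
    by apply/GR => // -[|j] jm //=; rewrite xy.
  exact: (ss_refl H (GI _ (sgI y))).
have stepA x y : x <> y -> (forall j l : 'I_m, j = l.+1 :> nat ->
    tnth (sval x) j = tnth (sval y) l) -> A (G (sg x)) (G (sg y)) \/ A (G (sg y)) (G (sg x)).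
  move=> ne xy; have xy' j : (j.+1 < m)%N -> sg x j.+1 = sg y j.
    move=> jm; have := xy (Ordinal jm) (Ordinal (ltnW jm)) erefl.
    by rewrite !sgE.
  have consI z z' : (sg z 0 < sg z' 0)%N ->
      inc m.+1 (fun j => if j is j'.+1 then sg z' j' else sg z 0).
    move=> lt [|j] [|l] //= jl lm; last exact: sgI.
    rewrite ltEnat /=; apply: leq_trans lt _.
    by case: l {jl} lm => // l lm; apply: ltnW; have := sgI z' 0 l.+1 isT lm; rewrite ltEnat.
  case: (ltnP 1 m) => [m1|m1].
    left; apply: shiftA => //; apply: consI; rewrite -xy' //.
    by have := sgI x 0 1 isT m1; rewrite ltEnat.
  (* For [m = 1] adjacency fixes no order, so the smaller entry is put first. *)
  have none j : (j.+1 < m)%N -> False by lia.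
  case: (ltngtP (sg x 0) (sg y 0)) => [lt|lt|eq0].
  - by left; apply: shiftA; [exact: consI|by move=> j /none].
  - by right; apply: shiftA; [exact: consI|by move=> j /none].
  - case: ne; apply/val_inj/eq_from_tnth => j; rewrite !sgE.
    by have -> : nat_of_ord j = 0 by have := ltn_ord j; lia.
exists f; split=> [x y Wx Wy|x y Dxy].
  have [j jx ->] := fP x Wx; have [l ly ->] := fP y Wy.
  move=> /(vP j l).1; rewrite jx ly => /(GR _ _ (sgI x) (sgI y)) xy.
  by apply/val_inj/eq_from_tnth => z; rewrite !sgE; apply: xy.
have [Wx Wy [ne xy]] := DW _ _ Dxy.
have [j jx ->] := fP x Wx; have [l ly ->] := fP y Wy.
have : A (G (sg x)) (G (sg y)) \/ A (G (sg y)) (G (sg x)).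
  case: xy => [|yx]; first exact: stepA.
  by have [] := stepA y x (nesym ne) yx; [right|left].
rewrite -jx -ly => -[/(vP j l).2 //|/(vP l j).2]; exact: E_graph.1.
Qed.

End Embedding.

Lemma card_leq_set1 (A : Type) : card_leq A (set A).
Proof. by apply/card_leqP; exists set1 => x y E; have : [set x] x by []; rewrite E. Qed.

(** A function from [set A] to [set B] is a subset of [set A * B]. Both index types embed in [Z],
    and [set Z * Z] embeds in [set (Z + Z)]. *)
Lemma few_colours (X Z P : Type) :
  card_leq nat Z -> card_leq X Z -> card_leq (set Z) P ->
  card_leq (set ((X + X) * (X + X)) -> set (nat * nat * nat)) (set P).
Proof.
move=> nZ XZ ZP; have ZZ := card_leq_square nZ.
have sumZ : card_leq (Z + Z) Z.
  move: nZ => /card_leqP[j ji]; apply: card_leq_trans ZZ; apply/card_leqP.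
  exists (fun s => match s with inl z => (j 0, z) | inr z => (j 1, z) end).
  by move=> [x|x] [y|y] //= [] => [->|/ji|/ji|->].
have XX : card_leq ((X + X) * (X + X)) Z.
  have XXZ : card_leq (X + X) Z.
    apply: card_leq_trans sumZ; move: XZ => /card_leqP[f fi]; apply/card_leqP.
    exists (fun s => match s with inl x => inl (f x) | inr x => inr (f x) end).
    by move=> [x|x] [y|y] //= [] /fi ->.
  exact: card_leq_trans (card_leq_prod XXZ XXZ) ZZ.
have nnn : card_leq (nat * nat * nat) Z.
  apply: card_leq_trans (card_leq_prod (card_leq_prod nZ nZ) nZ) _.
  exact: card_leq_trans (card_leq_prod ZZ (card_leq_refl Z)) ZZ.
have pairZ : card_leq (set Z * Z) P.
  apply: card_leq_trans ZP; apply: card_leq_trans (card_leq_set sumZ).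
  apply/card_leqP; exists (fun q s => match s with inl z => q.1 z | inr z => z = q.2 end).
  move=> [S z] [S' z'] E; congr pair.
    by apply/funext => y; have := congr1 (@^~ (inl y)) E.
  by have /= <- := congr1 (@^~ (inr z)) E.
apply: card_leq_trans (card_leq_set (card_leq_trans
  (card_leq_prod (card_leq_set XX) nnn) pairZ)).
apply/card_leqP; exists (fun c q => c q.1 q.2) => c c' E.
by apply/funext => t; apply/funext => q; have := congr1 (@^~ (t, q)) E.
Qed.

(** * Colouring the vertices of one formula and one order type *)

Section Piece.
Variables (L : language) (E : rel_symb L) (M : structure L).
Hypothesis E_graph : graph_rel (edge E (M := M)).
Variables (U : Type) (dk : Order.disp_t) (kappa : orderType dk) (alpha : U -> kappa).
Hypothesis hkappa : is_infinite_cardinal kappa.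
Variables (dt : Order.disp_t) (theta : orderType dt).
Hypotheses (wt : is_ordinal theta) (kt : ordinal_less kappa theta).
Variable a : forall i : U, incr_fun (alpha i) theta -> seq M.
Hypothesis a_ind : indiscernible a.
Variable x0 : M.
Variables (k : nat) (phi : formula L k.+1) (i : 'I_k -> U) (p : 'I_k -> nat).

Let X := index alpha i.
Let den := denotes a x0 phi p (i := i).

Definition otype (Y : Type) (h : Y -> theta) : set (Y * Y) := [set y | (h y.1 < h y.2)%O].

Lemma otype_eq (Y : Type) (h h' : Y -> theta) : otype h = otype h' -> same_order h h'.
Proof.
move=> hE y z; apply/idP/idP => lt.
  by have : otype h (y, z) by []; rewrite hE.
by have : otype h' (y, z) by []; rewrite -hE.
Qed.

Variables (aleph1 P : Type).
Hypotheses (haleph1 : is_succ_card nat aleph1) (hP : is_weak_power (kappa + aleph1) P).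

(** Every order type of pairs occurring on an edge yields the shift graphs or a colouring by
    [dichotomy]. In the latter case the product of these colourings over all order types is
    taken. *)
Lemma piece_colouring (q : set (X * X)) :
  (exists m : nat, (1 <= m)%N /\
     contains_finite_subgraphs (edge E (M := M)) (@shift_edge m _ nat)) \/
  exists c : M -> set P, forall x y,
    (exists2 f, den f x & otype f = q) -> (exists2 f, den f y & otype f = q) ->
    edge E x y -> c x <> c y.
Proof.
pose goal := exists m : nat, (1 <= m)%N /\
  contains_finite_subgraphs (edge E (M := M)) (@shift_edge m _ nat).
case: (pselect goal) => [|nogoal]; first by left.
right; have /choice[c cP] (tau : set ((X + X) * (X + X))) :
    exists c : (X -> theta) -> set (nat * nat * nat), forall f g x y,
      den f x -> den g y -> otype f = q -> otype g = q -> edge E x y ->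
      otype (join_fun f g) = tau -> c f <> c g.
  case: (pselect (exists f g x y, [/\ den f x, den g y, otype f = q, otype g = q &
      edge E x y /\ otype (join_fun f g) = tau])); last first.
    by move=> no; exists (fun=> set0) => f g x y fx gy fq gq xy ft; case: no; exists f, g, x, y.
  move=> [f0 [g0 [x [y [fx gy fq gq [xy ft]]]]]].
  have fg : same_order f0 g0 by apply: otype_eq; rewrite fq gq.
  case: (dichotomy wt fg) => [[c cP]|[n [F [F1 F2 F3]]]].
    exists c => f g _ _ _ _ _ _ _ gt; apply: cP; apply: otype_eq.
    by rewrite gt ft.
  case: nogoal.
  exact: (model_contains_shift E_graph hkappa wt kt a_ind fx gy xy F1 F2 F3).
have [Z [nZ XZ ZP]] := index_bound hkappa alpha i haleph1 hP.
have /card_leqP[code codeI] := few_colours nZ XZ ZP.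
have /choice[ff ffP] x : exists f, (exists2 f, den f x & otype f = q) ->
    den f x /\ otype f = q.
  case: (pselect (exists2 f, den f x & otype f = q)) => [[f fx fq]|no].
    by exists f.
  (* Vertices outside the piece receive an arbitrary code; one exists because [theta] is not
     empty. *)
  case: (pselect (exists f : X -> theta, True)) => [[f _]|nof]; first by exists f.
  have [_ [e _]] := kt; have [j0 _] := (card_leqP _ _).1 (infinite_cardinal_nat hkappa).
  by case: nof; exists (fun=> e (j0 0)).
exists (fun x => code (fun tau => c tau (ff x))) => x y /ffP[fx fq] /ffP[gy gq] xy.
move=> /codeI H; have := congr1 (@^~ (otype (join_fun (ff x) (ff y)))) H.
exact: (cP _ _ _ _ _ fx gy fq gq xy).
Qed.

End Piece.

Theorem theorem6p1
    (L : language) (E : rel_symb L) (hE : rel_arity E = 2)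
    (T : set (sentence L)) (hT : graph_theory E T)
    (dk : Order.disp_t) (kappa : orderType dk) (hkappa : is_infinite_cardinal kappa)
    (U : Type) (hU : inhabited U) (alpha : U -> kappa)
    (dt : Order.disp_t) (theta : orderType dt) (htheta : is_ordinal theta)
    (hkt : ordinal_less kappa theta)
    (G : structure L) (hG : models G T)
    (hEM : infinitary_EM_model G alpha theta)
    (aleph1 : Type) (haleph1 : is_succ_card nat aleph1)
    (P : Type) (hP : is_weak_power (kappa + aleph1)%type P)
    (dv : Order.disp_t) (varkappa : orderType dv)
    (hreg : is_regular_cardinal varkappa)
    (hgt : card_less (set P + {n : nat & formula L n} * U)%type varkappa)
    (chi : Type) (hchi : is_chromatic_number (@edge L E G) chi)
    (hge : card_leq varkappa chi) :
  exists n : nat, (1 <= n)%N /\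
    contains_finite_subgraphs (@edge L E G) (@shift_edge n _ nat).
Proof.
have [a a_ind a_dcl] := hEM; have E_graph := hT G hG; have [u0] := hU.
have big C : colourable (@edge L E G) C -> card_leq varkappa C.
  by move=> /(hchi.2 C); apply: card_leq_trans.
have nle C : card_leq C (set P + {n : nat & formula L n} * U) -> ~ card_leq varkappa C.
  by move=> le /card_leq_trans/(_ le); apply: hgt.2.
(* A graph without vertices would be coloured by the empty type. *)
have [x0 _] : exists x0 : G, True.
  apply: contrapT => nG; apply: (nle False).
    by apply/card_leqP; exists (False_rect _) => -[].
  by apply: big; exists (fun x => nG (ex_intro _ x I)) => x; case: nG; exists x.
have setP_small : ~ card_leq varkappa (set P).
  by apply: nle; apply/card_leqP; exists inl => x y [].
have formula_small n : ~ card_leq varkappa (formula L n).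
  apply: nle; apply/card_leqP.
  exists (fun phi => inr (existT (formula L) n phi, u0)) => phi psi [].
  exact: existT_inj2.
have U_small : ~ card_leq varkappa U.
  apply: nle; apply/card_leqP.
  by exists (fun u => inr (existT (formula L) 0 (Falsum L 0), u)) => u v [].
have nat_small : ~ card_leq varkappa nat.
  apply: nle; apply/card_leqP.
  by exists (fun n => inr (existT (formula L) n (Falsum L n), u0)) => m n [].
apply: contrapT => nogoal.
pose piece k (phi : formula L k.+1) (i : 'I_k -> U) (p : 'I_k -> nat) q c :=
  forall x y : G,
    (exists2 f, denotes a x0 phi p (i := i) f x & otype f = q) ->
    (exists2 f, denotes a x0 phi p (i := i) f y & otype f = q) ->
    edge E x y -> c x <> c y :> set P.
pose data := {k : nat & (formula L k.+1 * ('I_k -> U) * ('I_k -> nat))%type}.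
pose pattern (t : data) := set (index alpha (tagged t).1.2 * index alpha (tagged t).1.2).
have colour (s : {t : data & pattern t}) : exists c, piece _ (tagged (tag s)).1.1
    (tagged (tag s)).1.2 (tagged (tag s)).2 (tagged s) c.
  by have [/nogoal[]|//] := piece_colouring E_graph hkappa htheta hkt a_ind x0
    (tagged (tag s)).1.1 (tagged (tag s)).2 haleph1 hP (tagged s).
have [c cP] := choice colour.
have ex x : exists s : {t : data & pattern t}, exists2 f,
    denotes a x0 (tagged (tag s)).1.1 (tagged (tag s)).2 (i := (tagged (tag s)).1.2) f x &
    otype f = tagged s.
  have : dcl (Rg a) x by rewrite a_dcl.
  move=> /(dcl_denotes x0)[k [phi [i [p [f fx]]]]].
  by exists (existT pattern (existT _ k (phi, i, p)) (otype f)), f.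
have [s sP] := choice ex.
(* The piece of a vertex together with its colour there is a colouring of the whole graph, so by
   regularity it suffices that the pieces and the palette are small. *)
suff : ~ card_leq varkappa ({t : data & pattern t} * set P).
  apply; apply: big; exists (fun x => (s x, c (s x) x)) => x y xy [e].
  by rewrite e; apply: (cP (s y)) (sP y) xy; rewrite -e.
apply: (regular_prod hreg) => //.
apply: (regular_sigma hreg) => [|[k [[phi i] p]] le].
  apply: (regular_sigma hreg) => // k; apply: (regular_prod hreg).
    by apply: (regular_prod hreg) => //; apply: (regular_fun hreg).
  exact: (regular_fun hreg).
(* The order types for one formula are subsets of a square that embeds in [Z], hence they embed in
   [P]. *)
apply: setP_small.
have [Z [nZ XZ ZP]] := index_bound hkappa alpha i haleph1 hP.
apply: card_leq_trans le _; apply: card_leq_trans (card_leq_set1 P).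
apply: card_leq_trans ZP; apply: card_leq_set.
exact: card_leq_trans (card_leq_prod XZ XZ) (card_leq_square nZ).
Qed.
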